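(* Let $E$ be a Drinfeld $A$-module over $\operatorname{Spec}K$ of finite residual characteristic with stable reduction and period lattice $\Lambda$ defined over $K$. Then there is an integer $m\geqslant0$ such that the restricted adelic monodromy representation $\rho\colon I_K\to\mathrm{GL}(\hat TE)$ maps the ramification subgroup $I_K^{m}$ to $1$. Explicitly, if $\Lambda$ is generated by elements $\lambda_1,\dots,\lambda_n$, one can take $m=\max_i\|\lambda_i\|+1$.
   Context: $\mathbb{F}_q$ finite field of characteristic $p$; $K\supset\mathbb{F}_q$ local field of characteristic $p$ with $\mathcal{O}_K$, $\mathfrak{p}_K$, normalized valuation $v$; $K^s$, $G_K$, inertia $I_K$ with upper ramification filtration $I_K^u$. $F$ global function field over $\mathbb{F}_q$, $\infty$ a place, $A$ the ring of elements regular outside $\infty$. Drinfeld modules over $K$ or $\mathcal{O}_K$ as homomorphisms $A\to R[\tau]$ (over $\mathcal{O}_K$: reduction mod $\mathfrak{p}_K$ of the same rank); characteristic homomorphism $\iota$; finite residual characteristic $\iota(A)\subset\mathcal{O}_K$, residual characteristic $\mathfrak{p}_0=\iota^{-1}(\mathfrak{p}_K)$. Stable reduction (Drinfeld's Tate uniformization): there is a Drinfeld module $D$ over $\mathcal{O}_K$ and a Galois-stable, discrete, finitely generated projective $A$-submodule $\Lambda\subset D(K^s)$ with an analytic $A$-linear surjection $e_\Lambda\colon D\to E$ with kernel $\Lambda$; ''defined over $K$'' means $\Lambda\subset D(K)$. Height on $D(K)=K$ (coordinate over $\mathcal{O}_K$): $\|\lambda\|=\max\{0,-v(\lambda)\}$.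 Restricted adelic Tate module: $\hat TE=\varprojlim_\mathfrak{n}\operatorname{Hom}_A(\mathfrak{n}^{-1}/A,E(K^s))$ over proper ideals $\mathfrak{n}\subset A$ not contained in $\mathfrak{p}_0$ (isomorphic to $\prod_{\mathfrak{p}\ne\mathfrak{p}_0}T_\mathfrak{p}E$), and $\rho$ is the action of $I_K$ on it. *)

(* Defs.v *)
From HB Require Import structures.
From mathcomp Require Import all_boot all_order all_algebra all_field.
From mathcomp Require Import boolp.

Set Implicit Arguments.
Unset Strict Implicit.
Unset Printing Implicit Defensive.

Import Order.TTheory GRing.Theory Num.Theory.
Local Open Scope ring_scope.

(* A valuation is a function [w : L -> R] whose value at [0] is meaningless;
   the convention w(0) = +oo is built into [vge]. *)
Definition vge (R : numDomainType) (L : fieldType) (w : L -> R) (r : R) (x : L)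
  : Prop := x != 0 -> r <= w x.

Record valuation (R : numDomainType) (L : fieldType) (w : L -> R) : Prop :=
  { valuationM : forall x y, x != 0 -> y != 0 -> w (x * y) = w x + w y;
    valuationD : forall r x y, vge w r x -> vge w r y -> vge w r (x + y) }.

Definition normalized_valuation (L : fieldType) (w : L -> int) : Prop :=
  valuation w /\ exists pi, pi != 0 /\ w pi = 1.

Definition converges (R : numDomainType) (L : fieldType) (w : L -> R)
    (u : nat -> L) (l : L) : Prop :=
  forall r, exists n0, forall n, (n0 <= n)%N -> vge w r (u n - l).

Definition cauchy (R : numDomainType) (L : fieldType) (w : L -> R)
    (u : nat -> L) : Prop :=
  forall r, exists n0, forall m n,
    (n0 <= m)%N -> (n0 <= n)%N -> vge w r (u m - u n).

Record local_field (K : fieldType) (v : K -> int) : Prop :=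
  { local_valuation : normalized_valuation v;
    local_complete : forall u, cauchy v u -> exists l, converges v u l;
    local_residue_finite :
      exists s : seq K, forall x, vge v 0 x -> exists2 y, y \in s & vge v 1 (x - y) }.

Record separable_closure (K Ks : fieldType) (jK : {rmorphism K -> Ks}) : Prop :=
  { sep_algebraic : forall x : Ks, exists p : {poly K},
      separable_poly p /\ root (map_poly jK p) x;
    sep_closed : forall p : {poly Ks},
      separable_poly p -> (1 < size p)%N -> exists x, root p x }.

(* As [K] is complete, its valuation extends uniquely to [Ks]. *)
Definition extends_valuation (K Ks : fieldType) (jK : {rmorphism K -> Ks})
    (v : K -> int) (vs : Ks -> rat) : Prop :=
  valuation vs /\ forall x, x != 0 -> vs (jK x) = (v x)%:~R.

Definition galois_auto (K Ks : fieldType) (jK : {rmorphism K -> Ks})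
    (sigma : {rmorphism Ks -> Ks}) : Prop :=
  bijective sigma /\ forall x, sigma (jK x) = jK x.

Definition inertia (K Ks : fieldType) (jK : {rmorphism K -> Ks})
    (vs : Ks -> rat) (sigma : {rmorphism Ks -> Ks}) : Prop :=
  galois_auto jK sigma /\
  forall x, x != 0 -> 0 <= vs x -> sigma x - x != 0 -> 0 < vs (sigma x - x).

Section FiniteRamification.
Variables (K : fieldType) (L : splittingFieldType K) (w : L -> int).

(* Serre's numbering: G_i acts trivially on O_L / p_L^(i+1). *)
Definition lower_ram (i : int) : {set gal_of {:L}} :=
  [set g in 'Gal({:L} / 1)%g | `[< forall x : L, vge w 0 x -> vge w (i + 1) (g x - x) >]].

(* The value at u >= 0 of the Herbrand function, i.e. the integral over [0, u]
   of dt / (G_0 : G_t), where G_t := G_(ceil t). *)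
Definition herbrand_phi (u : rat) : rat :=
  let k := Num.truncn u in
  (\sum_(1 <= i < k.+1) #|lower_ram i%:Z|%:R
     + (u - k%:R) * #|lower_ram k.+1%:Z|%:R) / #|lower_ram 0|%:R.

(* G^s = G_u where phi(u) = s. *)
Definition upper_ram (s : rat) (g : gal_of {:L}) : Prop :=
  exists u : rat, [/\ 0 <= u, herbrand_phi u = s & g \in lower_ram (Num.ceil u)].

End FiniteRamification.

(* I_K^s for s >= 0: the automorphisms whose restriction to every finite Galois
   subextension L/K of Ks, embedded through [j], lies in Gal(L/K)^s; here [w] is
   the normalized valuation of L, the multiple e * vs of the restriction of vs. *)
Definition inertia_upper (K Ks : fieldType) (jK : {rmorphism K -> Ks})
    (vs : Ks -> rat) (s : rat) (sigma : {rmorphism Ks -> Ks}) : Prop :=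
  inertia jK vs sigma /\
  forall (L : splittingFieldType K) (j : {rmorphism L -> Ks}),
    galois 1 {:L} -> (forall c : K, j c%:A = jK c) ->
    exists (w : L -> int) (e : nat) (g : gal_of {:L}),
      [/\ normalized_valuation w,
          (0 < e)%N /\ (forall x, x != 0 -> (w x)%:~R = e%:R * vs (j x)),
          upper_ram w s g
        & forall x, sigma (j x) = j (g x)].

(* A global function field over Fq is a finite extension of Fq(t); its places
   are its normalized discrete valuations (trivial on the finite field Fq). *)
Definition constF (Fq : finFieldType) (F : fieldExtType {fraction {poly Fq}})
    (c : Fq) : F := (tofrac c%:P)%:A.

Definition regular_outside (F : fieldType) (inf : F -> int) (x : F) : Prop :=
  forall w : F -> int, normalized_valuation w ->
    (exists y, y != 0 /\ w y <> inf y) -> vge w 0 x.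

Definition regular_ring (F : fieldType) (inf : F -> int) (A : comNzRingType)
    (iA : {rmorphism A -> F}) : Prop :=
  injective iA /\ forall x, (exists a, iA a = x) <-> regular_outside inf x.

Definition ideal (A : comNzRingType) (I : A -> Prop) : Prop :=
  [/\ I 0, forall a b, I a -> I b -> I (a + b) & forall a b, I b -> I (a * b)].

Definition card_quotient (A : comNzRingType) (I : A -> Prop) (n : nat) : Prop :=
  exists f : 'I_n -> A, forall x, exists! i, I (x - f i).

Definition ideal_inv (F : fieldType) (A : comNzRingType)
    (iA : {rmorphism A -> F}) (I : A -> Prop) (x : F) : Prop :=
  forall a, I a -> exists b, x * iA a = iA b.

(* The twisted polynomial f = sum_i f_i tau^i over K, with tau c = c^q tau, is
   encoded by the polynomial with the same coefficients. *)
Definition tmul (q : nat) (K : fieldType) (f g : {poly K}) : {poly K} :=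
  \poly_(k < size f + size g) \sum_(i < k.+1) f`_i * g`_(k - i) ^+ (q ^ i).

Definition tact (q : nat) (K Ks : fieldType) (jK : {rmorphism K -> Ks})
    (f : {poly K}) (x : Ks) : Ks :=
  \sum_(i < size f) jK f`_i * x ^+ (q ^ i).

Section Drinfeld.
Variables (Fq : finFieldType) (K : fieldType) (iK : {rmorphism Fq -> K}).
Variables (F : fieldExtType {fraction {poly Fq}}).
Variables (A : comNzRingType) (iA : {rmorphism A -> F}).
Local Notation q := #|Fq|.

(* Fq-algebra homomorphisms A -> K[tau]. *)
Record tau_hom (phi : A -> {poly K}) : Prop :=
  { tau_homD : forall a b, phi (a + b) = phi a + phi b;
    tau_hom1 : phi 1 = 1;
    tau_homM : forall a b, phi (a * b) = tmul q (phi a) (phi b);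
    tau_homC : forall c a, iA a = constF F c -> phi a = (iK c)%:P }.

(* [d] is the tau-degree of the image of [f] modulo the coefficients in [Z]. *)
Definition has_tdeg (Z : K -> Prop) (f : {poly K}) (d : nat) : Prop :=
  ~ Z f`_d /\ forall i, (d < i)%N -> Z f`_i.

(* deg_tau (phi_a mod Z) = r * dim_Fq (A / a A). *)
Definition has_rank (Z : K -> Prop) (phi : A -> {poly K}) (r : nat) : Prop :=
  forall a d, a != 0 -> card_quotient (fun x => exists b, x = b * a) (q ^ d) ->
    has_tdeg Z (phi a) (r * d).

Definition drinfeld_module (phi : A -> {poly K}) : Prop :=
  tau_hom phi /\ exists r, (0 < r)%N /\ has_rank (fun c => c = 0) phi r.

Definition drinfeld_module_int (v : K -> int) (phi : A -> {poly K}) : Prop :=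
  [/\ tau_hom phi,
      forall a i, vge v 0 (phi a)`_i
    & exists r, [/\ (0 < r)%N, has_rank (fun c => c = 0) phi r
                  & has_rank (vge v 1) phi r]].

Definition drinfeld_char (phi : A -> {poly K}) (a : A) : K := (phi a)`_0.

Definition finite_residual_char (v : K -> int) (phi : A -> {poly K}) : Prop :=
  forall a, vge v 0 (drinfeld_char phi a).

Definition residual_char (v : K -> int) (phi : A -> {poly K}) (a : A) : Prop :=
  vge v 1 (drinfeld_char phi a).

Variables (Ks : fieldType) (jK : {rmorphism K -> Ks}) (vs : Ks -> rat).

Definition submodule (phi : A -> {poly K}) (Lam : Ks -> Prop) : Prop :=
  [/\ Lam 0, forall x y, Lam x -> Lam y -> Lam (x + y)
    & forall a x, Lam x -> Lam (tact q jK (phi a) x)].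

Definition generates (phi : A -> {poly K}) (Lam : Ks -> Prop) (n : nat)
    (lam : 'I_n -> Ks) : Prop :=
  (forall i, Lam (lam i)) /\
  forall x, Lam x -> exists c : 'I_n -> A,
    x = \sum_i tact q jK (phi (c i)) (lam i).

(* Lam is a retract of the A-module A^n. *)
Definition fg_projective (phi : A -> {poly K}) (Lam : Ks -> Prop) : Prop :=
  exists (n : nat) (g : 'I_n -> Ks) (h : Ks -> 'I_n -> A),
    [/\ forall i, Lam (g i),
        forall x y i, Lam x -> Lam y -> h (x + y) i = h x i + h y i,
        forall a x i, Lam x -> h (tact q jK (phi a) x) i = a * h x i
      & forall x, Lam x -> x = \sum_i tact q jK (phi (h x i)) (g i)].

Definition discrete_subgroup (Lam : Ks -> Prop) : Prop :=
  exists r : rat, forall x, Lam x -> vge vs r x -> x = 0.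

(* Functions given by an everywhere convergent power series over K. *)
Definition analytic (e : Ks -> Ks) : Prop :=
  exists c : nat -> K, forall x,
    converges vs (fun n => \sum_(i < n) jK (c i) * x ^+ i) (e x).

Record tate_uniformization (v : K -> int) (E D : A -> {poly K})
    (Lam : Ks -> Prop) (e : Ks -> Ks) : Prop :=
  { tate_reduction : drinfeld_module_int v D;
    tate_submodule : submodule D Lam;
    tate_galois : forall sigma, galois_auto jK sigma ->
      forall x, Lam x -> Lam (sigma x);
    tate_discrete : discrete_subgroup Lam;
    tate_fg_projective : fg_projective D Lam;
    tate_analytic : analytic e;
    tate_expD : forall x y, e (x + y) = e x + e y;
    tate_expA : forall a x, e (tact q jK (D a) x) = tact q jK (E a) (e x);
    tate_surjective : forall y, exists x, e x = y;
    tate_kernel : forall x, e x = 0 <-> Lam x }.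

Definition tate_index (v : K -> int) (E : A -> {poly K}) (I : A -> Prop) : Prop :=
  [/\ ideal I, ~ I 1 & exists a, I a /\ ~ residual_char v E a].

(* A-linear maps n^-1 / A -> E(Ks), as functions on n^-1. *)
Definition torsion_hom (E : A -> {poly K}) (I : A -> Prop) (f : F -> Ks) : Prop :=
  [/\ forall x y, ideal_inv iA I x -> ideal_inv iA I y -> f (x + y) = f x + f y,
      forall a x, ideal_inv iA I x -> f (iA a * x) = tact q jK (E a) (f x)
    & forall a, f (iA a) = 0].

(* Elements of the inverse limit of the Hom_A(n^-1 / A, E(Ks)); the transition
   maps are the restrictions. *)
Definition adelic_tate (v : K -> int) (E : A -> {poly K})
    (t : (A -> Prop) -> F -> Ks) : Prop :=
  (forall I, tate_index v E I -> torsion_hom E I (t I)) /\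
  (forall I J, tate_index v E I -> tate_index v E J -> (forall a, J a -> I a) ->
     forall x, ideal_inv iA I x -> t J x = t I x).

Definition adelic_tate_eq (v : K -> int) (E : A -> {poly K})
    (t t' : (A -> Prop) -> F -> Ks) : Prop :=
  forall I, tate_index v E I -> forall x, ideal_inv iA I x -> t I x = t' I x.

Definition rho (sigma : {rmorphism Ks -> Ks}) (t : (A -> Prop) -> F -> Ks) :=
  fun I x => sigma (t I x).

Definition rho_trivial (v : K -> int) (E : A -> {poly K})
    (sigma : {rmorphism Ks -> Ks}) : Prop :=
  forall t, adelic_tate v E t -> adelic_tate_eq v E (rho sigma t) t.

Lemma adelic_tate_rho v E sigma t :
  galois_auto jK sigma -> adelic_tate v E t -> adelic_tate v E (rho sigma t).
Proof.
move=> [_ sK] [tH tC]; split=> [I /tH[tD tA t0]|I J hI hJ JI x hx]; last first.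
  by rewrite /rho (tC I J).
split=> [x y hx hy|a x hx|a]; rewrite /rho.
- by rewrite tD // rmorphD.
- rewrite tA // /tact rmorph_sum; apply: eq_bigr => i _.
  by rewrite rmorphM rmorphXn sK.
- by rewrite t0 rmorph0.
Qed.

End Drinfeld.

(* The height of a point of D(K) = K; it vanishes at 0 since v(0) = +oo. *)
Definition height (K : fieldType) (v : K -> int) (x : K) : nat :=
  if x == 0 then 0%N else absz (Num.max 0 (- v x)).

(* Main.v *)
(* If [a] lies in [n] but not in [p_0], every value of an element of the Tate
   module is [e(x)] with [D_a(x)] in [Lambda], so it suffices that [sigma] fixes
   [x]; by [A]-linearity one may assume [D_a(x) = lambda_i]. The reduction of
   [D_a] is separable of degree [q^N], so the nonzero [a]-torsion of [D] consists
   of units and inertia acts trivially on it. If [g] in the lower ramification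
   group [G_i] of a finite Galois extension [L] containing [x] moves [x], then
   [g x - x] is a unit, while [w(g x - x) >= i + w(x)]; hence
   [i <= - w(x) = - e_L v(lambda_i) / q^N]. Since [L] can be chosen of
   ramification index [e_L <= q^N], this gives [i <= ||lambda_i||], and an
   automorphism in [G^s] lies in [G_i] for some [i >= s], because the Herbrand
   function satisfies [phi(u) <= u]. *)
Require Import Defs.
From HB Require Import structures.
From mathcomp Require Import all_boot all_order all_algebra all_field.
From mathcomp Require Import boolp lra zify ring.
From mathcomp Require Import pgroup.

Set Implicit Arguments.
Unset Strict Implicit.
Unset Printing Implicit Defensive.

Import Order.TTheory GRing.Theory Num.Theory.
Local Open Scope ring_scope.

(** * Valuations *)

Definition vgt (R : numDomainType) (L : fieldType) (w : L -> R) (r : R) (x : L)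
  : Prop := x != 0 -> r < w x.

Section Valuation.
Variables (R : realDomainType) (L : fieldType) (w : L -> R).
Hypothesis hw : valuation w.
Implicit Types (x y : L) (r s : R).

Lemma val1 : w 1 = 0.
Proof.
have := valuationM hw (oner_neq0 L) (oner_neq0 L).
by rewrite mulr1 => /eqP; rewrite -subr_eq subrr => /eqP.
Qed.

Lemma valX x n : x != 0 -> w (x ^+ n) = w x *+ n.
Proof.
move=> x0; elim: n => [|n IH]; first by rewrite expr0 val1.
by rewrite exprS valuationM ?expf_neq0 // IH mulrS.
Qed.

Lemma valV x : x != 0 -> w x^-1 = - w x.
Proof.
move=> x0; apply/eqP; rewrite -addr_eq0 -valuationM ?invr_neq0 //.
by rewrite mulVf // val1.
Qed.

Lemma val_unity x n : (0 < n)%N -> x ^+ n = 1 -> w x = 0.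
Proof.
move=> n0 xn; have x0 : x != 0.
  by apply: contra_eq_neq xn => ->; rewrite expr0n eqn0Ngt n0 eq_sym oner_neq0.
have := val1; rewrite -xn valX // => /eqP; rewrite mulrn_eq0.
by rewrite -leqn0 leqNgt n0 => /eqP.
Qed.

Lemma valN x : w (- x) = w x.
Proof.
have [->|x0] := eqVneq x 0; first by rewrite oppr0.
rewrite -mulN1r valuationM ?oppr_eq0 ?oner_eq0 //.
by rewrite (@val_unity (-1) 2) ?add0r // sqrrN expr1n.
Qed.

Lemma valXz x (n : int) : x != 0 -> w (x ^ n) = w x *~ n.
Proof.
move=> x0; case: n => n /=; first by rewrite -exprnP valX.
by rewrite NegzE -exprnN -exprVn valX ?invr_neq0 // valV // mulrNz mulNrn.
Qed.

Lemma vge0 r : vge w r 0. Proof. by rewrite /vge eqxx. Qed.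

Lemma vgt0 r : vgt w r 0. Proof. by rewrite /vgt eqxx. Qed.

Lemma vge_le r s x : r <= s -> vge w s x -> vge w r x.
Proof. by move=> rs hx x0; apply: le_trans (hx x0). Qed.

Lemma vge_gt r s x : r < s -> vge w s x -> vgt w r x.
Proof. by move=> rs hx x0; apply: lt_le_trans (hx x0). Qed.

Lemma vgtW r x : vgt w r x -> vge w r x.
Proof. by move=> hx x0; apply/ltW/hx. Qed.

Lemma vge_refl x : vge w (w x) x. Proof. by []. Qed.

Lemma vgeD r x y : vge w r x -> vge w r y -> vge w r (x + y).
Proof. exact: valuationD. Qed.

Lemma vgeN r x : vge w r x -> vge w r (- x).
Proof. by rewrite /vge oppr_eq0 valN. Qed.

Lemma vgeB r x y : vge w r x -> vge w r y -> vge w r (x - y).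
Proof. by move=> hx hy; apply: vgeD => //; apply: vgeN. Qed.

Lemma vgtD r x y : vgt w r x -> vgt w r y -> vgt w r (x + y).
Proof.
have [->|x0] := eqVneq x 0; first by rewrite add0r.
have [->|y0] := eqVneq y 0; first by rewrite addr0.
move=> /(_ x0) hx /(_ y0) hy; apply: (@vge_gt _ (Num.min (w x) (w y))).
  by rewrite lt_min hx hy.
by apply: vgeD => _; rewrite ge_min lexx ?orbT.
Qed.

Lemma vgtN r x : vgt w r x -> vgt w r (- x).
Proof. by rewrite /vgt oppr_eq0 valN. Qed.

Lemma vgtB r x y : vgt w r x -> vgt w r y -> vgt w r (x - y).
Proof. by move=> hx hy; apply: vgtD => //; apply: vgtN. Qed.

Lemma vge_sum r (I : Type) (s : seq I) (P : pred I) (F : I -> L) :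
  (forall i, P i -> vge w r (F i)) -> vge w r (\sum_(i <- s | P i) F i).
Proof.
move=> hF; elim/big_ind: _ => //; [exact: vge0 | exact: vgeD].
Qed.

Lemma vgt_sum r (I : Type) (s : seq I) (P : pred I) (F : I -> L) :
  (forall i, P i -> vgt w r (F i)) -> vgt w r (\sum_(i <- s | P i) F i).
Proof.
move=> hF; elim/big_ind: _ => //; [exact: vgt0 | exact: vgtD].
Qed.

Lemma vgeM r s x y : vge w r x -> vge w s y -> vge w (r + s) (x * y).
Proof.
move=> hx hy; rewrite /vge mulf_eq0 negb_or => /andP[x0 y0].
by rewrite valuationM // lerD ?hx ?hy.
Qed.

Lemma vgtM r s x y : vge w r x -> vgt w s y -> vgt w (r + s) (x * y).
Proof.
move=> hx hy; rewrite /vgt mulf_eq0 negb_or => /andP[x0 y0].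
by rewrite valuationM // ler_ltD ?hx ?hy.
Qed.

Lemma vgeM0 r x y : vge w 0 x -> vge w r y -> vge w r (x * y).
Proof. by move=> hx hy; rewrite -(add0r r); apply: vgeM. Qed.

Lemma vgtM0 r x y : vge w 0 x -> vgt w r y -> vgt w r (x * y).
Proof. by move=> hx hy; rewrite -(add0r r); apply: vgtM. Qed.

Lemma vgeX r x n : vge w r x -> vge w (r *+ n) (x ^+ n).
Proof.
case: n => [|n] hx; first by move=> _; rewrite expr0 val1.
rewrite /vge expf_eq0 /= => x0; rewrite valX // ler_wMn2r //; exact: hx.
Qed.

Lemma vgeX0 x n : vge w 0 x -> vge w 0 (x ^+ n).
Proof. by move=> hx; have := @vgeX 0 x n hx; rewrite mul0rn. Qed.

Lemma vge_eq0 x : (forall r, vge w r x) -> x = 0.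
Proof.
move=> hx; apply/eqP; apply: contraT => x0.
by have := hx (w x + 1) x0; rewrite gerDl ler10.
Qed.

Lemma val_dom x y : x != 0 -> vgt w (w x) y -> x + y != 0 /\ w (x + y) = w x.
Proof.
move=> x0 hy; have xy0 : x + y != 0.
  apply/eqP => /eqP; rewrite addr_eq0 => /eqP xy.
  have y0 : y != 0 by rewrite -oppr_eq0 -xy.
  by have := hy y0; rewrite xy valN ltxx.
split=> //; apply/eqP; rewrite eq_le; apply/andP; split; last first.
  by apply: (vgeD _ _ xy0) => //; apply: vgtW.
rewrite leNgt; apply/negP => lt.
have : vgt w (w x) ((x + y) - y) by apply: vgtB => // _.
by rewrite addrK => /(_ x0); rewrite ltxx.
Qed.

Lemma vgt_val x y : x != 0 -> vgt w (w x) (x - y) -> y != 0 /\ w y = w x.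
Proof.
by move=> x0 /vgtN; rewrite opprB => /(val_dom x0); rewrite subrKC.
Qed.

Lemma sum_dom (I : finType) (F : I -> L) (k : I) :
  F k != 0 -> (forall i, i != k -> vgt w (w (F k)) (F i)) ->
  \sum_i F i != 0 /\ w (\sum_i F i) = w (F k).
Proof.
by move=> k0 hF; rewrite (bigD1 k) //=; apply: val_dom => //; apply: vgt_sum.
Qed.

Lemma sum_distinct_val (I : finType) (F : I -> L) (k : I) :
  F k != 0 ->
  (forall i j, F i != 0 -> F j != 0 -> w (F i) = w (F j) -> i = j) ->
  \sum_i F i != 0.
Proof.
move=> k0 inj.
have [m m0 minm] : exists2 m, F m != 0 & forall i, F i != 0 -> w (F m) <= w (F i).
  have [m m0 minm] :=
    @arg_minP _ _ I k (fun i => F i != 0) (fun i => w (F i)) k0.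
  by exists m.
have [] := @sum_dom I F m m0 _ => // i im i0.
by rewrite lt_neqAle minm // andbT; apply: contra_neq im => /(inj _ _ m0 i0).
Qed.

Lemma vgt_prod (s : seq L) : 
  (forall x, x \in s -> vge w 0 x) -> vgt w 0 (\prod_(x <- s) x) ->
  exists2 x, x \in s & vgt w 0 x.
Proof.
elim: s => [|x s IH] hs.
  by rewrite big_nil => /(_ (oner_neq0 L)); rewrite val1 ltxx.
rewrite big_cons => hp.
have hx := hs x (mem_head _ _).
case: (pselect (vgt w 0 x)) => nx; first by exists x; rewrite ?mem_head.
have x0 : x != 0 by apply: contra_notN nx => /eqP->; apply: vgt0.
have wx : w x = 0.
  apply/eqP; rewrite eq_le (hx x0) andbT leNgt; apply/negP => lt.
  by apply: nx => _.
have [|y0|y ys hy] := IH; last by exists y; rewrite // in_cons ys orbT.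
  by move=> y ys; apply: hs; rewrite in_cons ys orbT.
have := hp; rewrite /vgt mulf_eq0 negb_or x0 y0 => /(_ isT).
by rewrite valuationM // wx add0r.
Qed.

End Valuation.

(** * Finite subextensions of a separable closure *)

Definition subring_pred (R : pzRingType) (S : R -> Prop) : Prop :=
  [/\ S 1, forall x y, S x -> S y -> S (x - y)
    & forall x y, S x -> S y -> S (x * y)].

Section SubringPred.
Variables (R : pzRingType) (S : R -> Prop).
Hypothesis hS : subring_pred S.

Lemma subring_pred0 : S 0.
Proof. by have [S1 SB _] := hS; rewrite -(subrr 1); apply: (SB). Qed.

Lemma subring_predD x y : S x -> S y -> S (x + y).
Proof.
move=> Sx Sy; have [_ SB _] := hS; rewrite -(opprK y); apply: (SB) => //.
by rewrite -sub0r; apply: (SB) => //; apply: subring_pred0.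
Qed.

Lemma subring_predX x n : S x -> S (x ^+ n).
Proof.
move=> Sx; have [S1 _ SM] := hS; elim: n => [|n IH]; first by rewrite expr0.
by rewrite exprS; apply: (SM).
Qed.

Lemma subring_pred_sum (I : Type) (r : seq I) (P : pred I) (F : I -> R) :
  (forall i, P i -> S (F i)) -> S (\sum_(i <- r | P i) F i).
Proof.
move=> SF; elim/big_ind: _ => //; first exact: subring_pred0.
exact: subring_predD.
Qed.

End SubringPred.

Lemma irreducible_annihilator (K Ks : fieldType) (jK : {rmorphism K -> Ks})
  (p : {poly K}) (x : Ks) :
  p != 0 -> root (map_poly jK p) x ->
  exists2 q, irreducible_poly q & root (map_poly jK q) x.
Proof.
move=> p0 px.
pose P n := `[< exists q : {poly K},
  [/\ q != 0, root (map_poly jK q) x & size q = n] >].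
have exP : exists n, P n by exists (size p); apply/asboolP; exists p.
case: (ex_minnP exP) => m /asboolP[q [q0 qx sq]] minq.
exists q => //; apply/(@subfx_irreducibleP _ _ jK x q qx q0) => r rx r0.
by rewrite sq; apply: minq; apply/asboolP; exists r.
Qed.

Section Subextension.
Variables (K Ks : fieldType) (jK : {rmorphism K -> Ks}).

Lemma adjoin_root (L : fieldExtType K) (j : {rmorphism L -> Ks}) (x : Ks) :
  (forall c, j c%:A = jK c) ->
  (exists2 p : {poly L}, irreducible_poly p & root (map_poly j p) x) ->
  exists (M : fieldExtType K) (k : {rmorphism M -> Ks}),
    [/\ forall c, k c%:A = jK c, exists y, k y = x, forall y, exists z, k z = j y
      & forall S, subring_pred S -> (forall y, S (j y)) -> S x ->
          forall y, S (k y)].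
Proof.
move=> jE [p irr px].
pose M0 : fieldExtType L := SubFieldExtType px irr.
pose k : {rmorphism M0 -> Ks} := @subfx_inj L Ks j x p.
have p0 := irredp_neq0 irr.
have kE b : k b%:A = j b by apply: subfx_inj_base.
exists (baseFieldType M0), k; split.
- by move=> c; rewrite -jE -kE; congr (k _); exact: (@baseField_scaleE K L M0 c 1).
- exists (@subfx_root L Ks j x p); exact: subfx_inj_root.
- by move=> y; exists (y%:A : M0).
move=> S hS Sj Sx y.
have [q ->] := @subfxEroot L Ks j x p px p0 y.
rewrite -[k _]horner_map /= subfx_inj_root // -map_poly_comp.
rewrite (eq_map_poly (@subfx_inj_base L Ks j x p px p0)).
rewrite horner_coef; apply: subring_pred_sum => // i _.
case: (hS) => _ _ SM; apply: (SM); first by rewrite coef_map; exact: Sj.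
exact: subring_predX.
Qed.

Lemma finite_subextension (rs : seq Ks) :
  (forall r, r \in rs -> exists2 p : {poly K}, p != 0 & root (map_poly jK p) r) ->
  exists (L : fieldExtType K) (j : {rmorphism L -> Ks}),
    [/\ forall c, j c%:A = jK c, forall r, r \in rs -> exists y, j y = r
      & forall S, subring_pred S -> (forall c, S (jK c)) ->
          (forall r, r \in rs -> S r) -> forall y, S (j y)].
Proof.
elim: rs => [|r rs IH] alg.
  exists K^o, jK; split=> [c||S hS SK _ y]; [|by []|exact: SK].
  by rewrite /GRing.scale /= mulr1.
have [L [j [jE jrs jS]]] : exists (L : fieldExtType K) (j : {rmorphism L -> Ks}),
    [/\ forall c, j c%:A = jK c, forall r, r \in rs -> exists y, j y = r
      & forall S, subring_pred S -> (forall c, S (jK c)) ->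
          (forall r, r \in rs -> S r) -> forall y, S (j y)].
  by apply: IH => s srs; apply: alg; rewrite in_cons srs orbT.
have [p p0 pr] := alg r (mem_head _ _).
have pr' : exists2 q : {poly L}, irreducible_poly q & root (map_poly j q) r.
  apply: (@irreducible_annihilator L Ks j (map_poly (in_alg L) p)).
    by rewrite map_poly_eq0.
  by rewrite -map_poly_comp (eq_map_poly jE).
have [M [k [kE [y ky] kj kS]]] := adjoin_root jE pr'.
exists M, k; split=> // [s|S hS SK Srs].
  rewrite in_cons => /orP[/eqP->|/jrs[z <-]]; [by exists y | exact: kj].
apply: kS => // [z|]; last by apply: Srs; rewrite mem_head.
by apply: jS => // s srs; apply: Srs; rewrite in_cons srs orbT.
Qed.

End Subextension.

Lemma separable_splits (Ks : fieldType) :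
  (forall p : {poly Ks}, separable_poly p -> (1 < size p)%N -> exists x, root p x) ->
  forall p : {poly Ks}, separable_poly p ->
    exists rs : seq Ks, p %= \prod_(r <- rs) ('X - r%:P).
Proof.
move=> clos p; have [n] := ubnP (size p); elim: n p => // n IH p lt sep.
have p0 := separable_poly_neq0 sep.
case: (leqP (size p) 1) => sp.
  exists [::]; rewrite big_nil -size_poly_eq1 eqn_leq sp.
  by rewrite size_poly_gt0.
have [x /factor_theorem[q pq]] := clos p sep sp.
have q0 : q != 0 by apply: contra_neq p0 => q0; rewrite pq q0 mul0r.
have [||rs qE] := IH q.
- by move: lt; rewrite pq size_Mmonic ?monicXsubC // size_XsubC addn2 ltnS.
- by apply: dvdp_separable sep; rewrite pq dvdp_mulr.
by exists (x :: rs); rewrite big_cons pq mulrC eqp_mull.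
Qed.

Section SplittingSubext.
Variables (K Ks : fieldType) (jK : {rmorphism K -> Ks}).
Hypothesis hKs : separable_closure jK.

Lemma splitting_subextension (p : {poly K}) (rs : seq Ks) :
  p != 0 -> map_poly jK p %= \prod_(r <- rs) ('X - r%:P) ->
  exists (L : splittingFieldType K) (j : {rmorphism L -> Ks}),
    [/\ galois 1 {:L}, forall c, j c%:A = jK c,
        exists ls, map j ls = rs
      & forall S, subring_pred S -> (forall c, S (jK c)) ->
          (forall r, r \in rs -> S r) -> forall y, S (j y)].
Proof.
move=> p0 prs.
have rootrs r : r \in rs -> root (map_poly jK p) r.
  by move=> rrs; rewrite (eqp_root prs) root_prod_XsubC.
have [|L [j [jE jrs jS]]] := @finite_subextension K Ks jK rs.
  by move=> r /rootrs; exists p.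
have [ls jls] : exists ls, map j ls = rs.
  elim: (rs) jrs => [|r s IH] js; first by exists [::].
  have [z zs|ls jls] := IH; first by apply: js; rewrite in_cons zs orbT.
  have [y jy] := js r (mem_head _ _).
  by exists (y :: ls); rewrite /= jls jy.
have spl : SplittingField.axiom L.
  exists (map_poly (in_alg L) p).
    by apply/polyOverP => i; rewrite coef_map /= rpredZ // mem1v.
  exists ls.
    rewrite -(eqp_map j) -map_poly_comp (eq_map_poly jE).
    rewrite rmorph_prod /=; move: prs; rewrite -jls big_map.
    under [X in _ -> is_true (_ %= X)]eq_bigr => i _ do
      rewrite rmorphB /= map_polyX map_polyC.
    by [].
  apply/eqP; rewrite eqEsubv subvf; apply/subvP => y _.
  pose S z := exists2 y, y \in <<1 & ls>>%VS & j y = z.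
  have [|||z zls /fmorph_inj <-//] := jS S _ _ _ y.
  - split; first by exists 1; rewrite ?rmorph1 // mem1v.
      by move=> _ _ [a ? <-] [b ? <-]; exists (a - b); rewrite ?rmorphB // rpredB.
    move=> _ _ [a ? <-] [b ? <-]; exists (a * b); rewrite ?rmorphM //.
    exact: (@rpredM _ <<1 & ls>>%AS).
  - by move=> c; exists c%:A; rewrite // rpredZ // mem1v.
  - move=> r; rewrite -jls => /mapP[x xls ->]; exists x => //.
    exact: seqv_sub_adjoin.
pose L' : splittingFieldType K :=
  HB.pack (FieldExt.sort L) (FieldExt_isSplittingField.Build K L spl).
exists L', j; split=> //; last by exists ls.
rewrite /galois sub1v normalFieldf andbT /=.
apply/separableP => y _; rewrite /separable_element.
have [q [sepq qy]] := sep_algebraic hKs (j y).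
have : separable_poly (map_poly (in_alg L') q) by rewrite separable_map.
apply: dvdp_separable; apply: minPoly_dvdp.
  by apply/polyOverP => i; rewrite coef_map /= rpredZ // mem1v.
by move: qy; rewrite -(eq_map_poly jE) map_poly_comp fmorph_root.
Qed.

End SplittingSubext.

(** * Finite quotients of the ring of regular functions *)

Lemma fraction_denominator (R : idomainType) (x : {fraction R}) :
  exists d n : R, d != 0 /\ tofrac d * x = tofrac n.
Proof.
elim/quotW: x => r; exists (\d_r), (\n_r); split; first exact: denom_ratioP.
rewrite !piE; apply/eqmodP => /=.
rewrite FracField.equivfE /FracField.mulf !numden_Ratio ?oner_eq0 //.
  by rewrite mulr1 mul1r.
all: by rewrite mul1r; apply: denom_ratioP.
Qed.

Section PolynomialRelations.
Variables (Fq : finFieldType) (F : fieldExtType {fraction {poly Fq}}).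
Local Notation m := (\dim {:F}).
Local Notation b := (vbasis {:F}).

Definition poly_scalar := in_alg F \o @tofrac {poly Fq}.
HB.instance Definition _ := GRing.RMorphism.on poly_scalar.

Definition const_morph := poly_scalar \o polyC.
HB.instance Definition _ := GRing.RMorphism.on const_morph.

Lemma const_morphE c : const_morph c = constF F c. Proof. by []. Qed.

Lemma poly_scalar_eq0 p : (poly_scalar p == 0) = (p == 0).
Proof. by rewrite /poly_scalar /= scaler_eq0 oner_eq0 orbF tofrac_eq0. Qed.

Definition poly_coords (N : nat) (x : F) : Prop :=
  exists P : 'I_m -> {poly Fq}, (forall k, size (P k) <= N)%N /\
    x = \sum_k poly_scalar (P k) * b`_k.

Lemma poly_coords_le N N' x : (N <= N')%N -> poly_coords N x -> poly_coords N' x.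
Proof.
by move=> NN [P [sP ->]]; exists P; split=> // k; apply: leq_trans NN.
Qed.

Lemma poly_coords0 N : poly_coords N 0.
Proof.
exists (fun _ => 0); split=> [k|]; first by rewrite size_poly0.
by rewrite big1 // => k _; rewrite rmorph0 mul0r.
Qed.

Lemma poly_coordsD N x y :
  poly_coords N x -> poly_coords N y -> poly_coords N (x + y).
Proof.
move=> [P [sP ->]] [Q [sQ ->]]; exists (fun k => P k + Q k); split=> [k|].
  by rewrite (leq_trans (size_polyD _ _)) // geq_max sP sQ.
by rewrite -big_split; apply: eq_bigr => k _; rewrite rmorphD mulrDl.
Qed.

Lemma poly_coordsZ N M (p : {poly Fq}) x : (size p <= M)%N ->
  poly_coords N x -> poly_coords (N + M) (poly_scalar p * x).
Proof.
move=> pM [P [sP ->]]; exists (fun k => p * P k); split=> [k|].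
  have := size_polyMleq p (P k); have := sP k; lia.
rewrite big_distrr; apply: eq_bigr => k _; rewrite rmorphM. by rewrite /= mulrA.
Qed.

Lemma poly_coords_denominator (I : finType) (x : I -> F) :
  exists d N, d != 0 /\ forall i, poly_coords N (poly_scalar d * x i).
Proof.
suff H (s : seq {fraction {poly Fq}}) : exists d : {poly Fq}, d != 0 /\
    forall c, c \in s -> exists n, tofrac d * c = tofrac n.
  pose s := [seq coord b k (x i) | i <- enum I, k <- enum 'I_m].
  have [d [d0 dP]] := H s.
  have {}dP i k : exists n, tofrac d * coord b k (x i) = tofrac n.
    by apply: dP; apply: allpairs_f; rewrite mem_enum.
  have [n nP] := choice (fun ik : I * 'I_m => dP ik.1 ik.2).
  exists d, (\max_ik size (n ik))%N; split=> // i.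
  exists (fun k => n (i, k)); split=> [k|].
    exact: (leq_bigmax_cond (F := fun ik => size (n ik))).
  rewrite {1}(coord_vbasis (memvf (x i))) big_distrr; apply: eq_bigr => k _.
  rewrite /poly_scalar /= -(nP (i, k)) /= !mulr_algl scalerA //.
elim: s => [|c s [d [d0 dP]]]; first by exists 1; rewrite oner_eq0.
have [d' [n' [d'0 d'c]]] := fraction_denominator c.
exists (d * d'); split; first by rewrite mulf_neq0.
move=> c'; rewrite in_cons => /orP[/eqP->|/dP[n nE]].
  by exists (d * n'); rewrite tofracM -mulrA d'c tofracM.
by exists (d' * n); rewrite tofracM mulrAC nE tofracM mulrC.
Qed.

Lemma poly_coords_mul (a : F) : exists d C, d != 0 /\
  forall N x, poly_coords N x ->
    poly_coords (N + C) (poly_scalar d * x) /\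
    poly_coords (N + C) (poly_scalar d * (a * x)).
Proof.
have [d [C [d0 dC]]] := poly_coords_denominator (fun k : 'I_m => a * b`_k).
exists d, (maxn C (size d)); split=> // N x hx; split.
  by apply: poly_coordsZ hx; rewrite leq_maxr.
have [P [sP ->]] := hx; rewrite !big_distrr /=.
elim/big_ind: _ => [||k _]; [exact: poly_coords0 | exact: poly_coordsD |].
have := poly_coordsZ (sP k) (dC k); rewrite addnC => /(poly_coords_le _) H.
have -> : poly_scalar d * (a * (poly_scalar (P k) * b`_k)) =
  poly_scalar (P k) * (poly_scalar d * (a * b`_k)) by ring.
by apply: H; rewrite leq_add2l leq_maxl.
Qed.

(* Dimension count over [Fq]: up to a common denominator, the [S n] products
   a^s x_i with s < S lie in a space of dimension at most m (B + S C), where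
   only [B] depends on the [x_i]. *)
Lemma polynomial_relation (a : F) : exists n, forall x : 'I_n -> F,
  exists c : 'I_n -> {poly Fq}, (exists i, c i != 0) /\
    \sum_i (map_poly const_morph (c i)).[a] * x i = 0.
Proof.
have [d [C [d0 dC]]] := poly_coords_mul a.
exists (m * C).+1 => x; set n := (m * C).+1.
have [d' [B [d'0 d'B]]] := poly_coords_denominator x.
pose S := (m * B).+1; pose N := (B + S * C)%N.
pose y (s : 'I_S) i := poly_scalar d ^+ S * (a ^+ s * (poly_scalar d' * x i)).
have yP s i : poly_coords N (y s i).
  have H t u : (t <= u)%N -> poly_coords (B + u * C)
    (poly_scalar d ^+ u * (a ^+ t * (poly_scalar d' * x i))).
    elim: u t => [|u IH] t; first by rewrite leqn0 => /eqP->; rewrite !mul1r addn0.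
    rewrite mulSn [(C + _)%N]addnC addnA.
    case: t => [|t] tu.
      by rewrite exprS -mulrA; apply: (dC _ _ _).1; apply: IH.
    have := (dC _ _ (IH t tu)).2.
    by rewrite [in X in _ -> X]exprS [in X in _ -> X]exprS; congr poly_coords; ring.
  by apply: H; apply: ltnW.
have [P PP] := choice (fun si : 'I_S * 'I_n => yP si.1 si.2).
pose f (c : {ffun 'I_S * 'I_n -> Fq}) : {ffun 'I_m * 'I_N -> Fq} :=
  [ffun kl : 'I_m * 'I_N => \sum_si c si * (P si kl.1)`_kl.2].
have q1 : (1 < #|Fq|)%N by apply: finNzRing_gt1.
have : ~~ injectiveb f.
  apply/injectiveP => /leq_card; rewrite !card_ffun !card_prod !card_ord.
  by rewrite leq_exp2l //; rewrite /N /n /S; nia.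
case/injectivePn => c1 [c2 c12 fc].
pose c si := c1 si - c2 si.
have rel : \sum_si const_morph (c si) * y si.1 si.2 = 0.
  under eq_bigr => si _ do rewrite (PP si).2 big_distrr /=.
  rewrite exchange_big big1 //= => k _.
  under eq_bigr => si _ do rewrite mulrA -[const_morph _]/(poly_scalar _%:P)
    -(rmorphM poly_scalar).
  rewrite -big_distrl -rmorph_sum /=.
  suff -> : \sum_si (c si)%:P * P si k = 0 by rewrite rmorph0 mul0r.
  apply/polyP => l; rewrite coef0 coef_sum.
  under eq_bigr => si _ do rewrite coefCM mulrBl.
  rewrite sumrB; case: (ltnP l N) => lN.
    have /ffunP/(_ (k, Ordinal lN)) := fc; rewrite !ffunE /= => ->.
    by rewrite subrr.
  rewrite !big1 ?subrr // => si _; rewrite nth_default ?mulr0 //;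
    exact: leq_trans ((PP si).1 k) lN.
exists (fun i => \poly_(s < S) c (inord s, i)); split.
  have [[s i] si] : exists si, c1 si != c2 si.
    apply/existsP; rewrite -negb_forall; apply: contra c12 => /forallP e12.
    by apply/eqP/ffunP => si; apply/eqP.
  exists i; apply/eqP => /polyP/(_ s); rewrite coef_poly ltn_ord coef0 inord_val.
  by move/eqP; rewrite subr_eq0 (negbTE si).
have D0 : poly_scalar d ^+ S * poly_scalar d' != 0.
  by rewrite mulf_neq0 ?expf_neq0 // poly_scalar_eq0.
apply: (mulfI D0); rewrite mulr0 -[RHS]rel big_distrr /=.
transitivity (\sum_s \sum_i const_morph (c (s, i)) * y s i); last first.
  by rewrite pair_bigA; apply: eq_bigr => -[s i].
rewrite exchange_big.
apply: eq_bigr => i _; rewrite (@horner_coef_wide _ S); last first.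
  by rewrite (leq_trans (size_poly _ _)) // size_poly.
rewrite big_distrl big_distrr; apply: eq_bigr => s _.
rewrite coef_map coef_poly ltn_ord inord_val /y [LHS]/=.
have E (u1 u2 u3 u4 u5 : F) :
  u2 * u3 * (u1 * u4 * u5) = u1 * (u2 * (u4 * (u3 * u5))) by ring.
exact: E.
Qed.

End PolynomialRelations.

Section RelationModulo.
Variables (k : nzRingType) (A : comNzRingType) (kA : {rmorphism k -> A}).

Lemma relation_modulo (a : A) (n : nat) (x : 'I_n -> A) (c : 'I_n -> {poly k}) :
  GRing.lreg a -> (exists i, c i != 0) ->
  \sum_i (map_poly kA (c i)).[a] * x i = 0 ->
  exists (d : 'I_n -> k) (y : A), (exists i, d i != 0) /\
    \sum_i kA (d i) * x i = y * a.
Proof.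
move=> a_reg; have [N] := ubnP (\sum_i size (c i))%N.
elim: N c => // N IH c lt [i0 ci0] rel.
pose c' i := drop_poly 1 (c i).
have dec i : c i = c' i * 'X + ((c i)`_0)%:P.
  apply/polyP => l; rewrite coefD coefMX coefC coef_drop_poly.
  by case: l => [|l] /=; rewrite ?add0r // addr0 addn1.
have rel' : \sum_i kA (c i)`_0 * x i =
    - (\sum_i (map_poly kA (c' i)).[a] * x i) * a.
  apply/eqP; rewrite mulNr -addr_eq0 addrC; apply/eqP; rewrite -[RHS]rel.
  rewrite big_distrl -big_split; apply: eq_bigr => i _ /=.
  rewrite [in RHS]dec rmorphD rmorphM /= map_polyX map_polyC !hornerE /=; ring.
have [/existsP[i hi]|all0] := boolP [exists i, (c i)`_0 != 0].
  by exists (fun i => (c i)`_0), (- (\sum_i (map_poly kA (c' i)).[a] * x i));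
    split; [exists i | exact: rel'].
have {all0} c0 i : (c i)`_0 = 0.
  by apply/eqP; apply: contraT => ci; case/negP: all0; apply/existsP; exists i.
apply: (IH c').
- have szc' i : (size (c' i) <= size (c i))%N by rewrite size_drop_poly leq_subr.
  rewrite ltnS in lt; apply: leq_trans lt.
  rewrite (bigD1 i0) // [X in (_ < X)%N](bigD1 i0) //=.
  rewrite -addSn leq_add ?leq_sum // size_drop_poly.
  by move: ci0; rewrite -size_poly_gt0 => ci0; rewrite subn1 prednK.
- exists i0; apply: contra_neq ci0 => ci0.
  by rewrite dec ci0 c0 mul0r add0r polyC0.
apply: a_reg; rewrite mulr0 mulrC; apply/eqP; rewrite -oppr_eq0 -mulNr -rel'.
by apply/eqP; rewrite big1 // => i _; rewrite c0 rmorph0 mul0r.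
Qed.

End RelationModulo.

Lemma card_quotient_exp (Fq : finFieldType) (A : comNzRingType)
    (kA : {rmorphism Fq -> A}) (J : A -> Prop) (n : nat) :
  ideal J ->
  (forall x : 'I_n -> A, exists d : 'I_n -> Fq, (exists i, d i != 0) /\
     J (\sum_i kA (d i) * x i)) ->
  exists d, card_quotient J (#|Fq| ^ d).
Proof.
move=> [J0 JD JM] dep.
have JN x : J x -> J (- x) by rewrite -mulN1r; apply: JM.
have JB x y : J x -> J y -> J (x - y) by move=> hx hy; apply: JD => //; apply: JN.
pose indep d (x : 'I_d -> A) :=
  forall c : 'I_d -> Fq, J (\sum_i kA (c i) * x i) -> forall i, c i = 0.
pose P d := `[< exists x, @indep d x >].
have exP : exists d, P d.
  by exists 0%N; apply/asboolP; exists (fun _ => 0) => c _ [].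
have ubP d : P d -> (d <= n)%N.
  move=> /asboolP[x xi]; rewrite leqNgt; apply/negP => nd.
  have [c [[i ci] Jc]] := dep (fun i => x (widen_ord (ltnW nd) i)).
  pose c' (k : 'I_d) := if insub (val k) is Some i then c i else 0.
  have c'E l : c' (widen_ord (ltnW nd) l) = c l.
    by rewrite /c' /= insubT //= => ?; congr c; apply: val_inj.
  suff J' : J (\sum_k kA (c' k) * x k).
    by move: ci; rewrite -c'E (xi c' J') eqxx.
  rewrite (bigID (fun k : 'I_d => (k < n)%N)) /= [X in _ + X]big1 ?addr0.
    rewrite (big_ord_narrow (ltnW nd)) /=.
    by under eq_bigr => k _ do rewrite c'E.
  by move=> k nk; rewrite /c' insubF ?rmorph0 ?mul0r //; apply/negbTE.
case: (ex_maxnP exP ubP) => d /asboolP[x xi] maxd.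
have span y : exists c : 'I_d -> Fq, J (y - \sum_i kA (c i) * x i).
  apply: contrapT => nspan.
  have /maxd : P d.+1; last by rewrite ltnn.
  apply/asboolP; exists (fun i => if unlift ord0 i is Some k then x k else y).
  move=> c; rewrite big_ord_recl unlift_none.
  under eq_bigr => i _ do rewrite liftK.
  move=> Jc; have c0 : c ord0 = 0.
    apply/eqP; apply: contra_notT nspan => c0.
    exists (fun k => - (c (lift ord0 k) / c ord0)).
    have -> : y - \sum_i kA (- (c (lift ord0 i) / c ord0)) * x i =
       kA (c ord0)^-1 *
       (kA (c ord0) * y + \sum_(i < d) kA (c (lift ord0 i)) * x i).
      rewrite mulrDr mulrA -rmorphM mulVf // rmorph1 mul1r -sumrN big_distrr /=.
      congr (_ + _); apply: eq_bigr => i _.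
      by rewrite rmorphN mulNr opprK mulrA -rmorphM [_^-1 * _]mulrC.
    exact: JM.
  move: Jc; rewrite c0 rmorph0 mul0r add0r => /xi ci i.
  by case: (unliftP ord0 i) => [k|] ->; rewrite ?ci.
exists d; have cardE : #|{: {ffun 'I_d -> Fq}}| = (#|Fq| ^ d)%N.
  by rewrite card_ffun card_ord.
pose g (i : 'I_(#|Fq| ^ d)) : {ffun 'I_d -> Fq} :=
  enum_val (cast_ord (esym cardE) i).
exists (fun i => \sum_k kA (g i k) * x k) => y.
have [c cP] := span y.
exists (cast_ord cardE (enum_rank (finfun c))); split.
  rewrite /g cast_ordK enum_rankK.
  by under eq_bigr => k _ do rewrite ffunE.
move=> i iP; apply: (can_inj (cast_ordK (esym cardE))).
rewrite cast_ordK; apply: enum_val_inj; rewrite enum_rankK.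
apply/ffunP => k; rewrite ffunE; apply/eqP; rewrite -subr_eq0; apply/eqP.
apply: (xi (fun k => c k - g i k)).
have -> : \sum_k kA (c k - g i k) * x k =
   (y - \sum_k kA (g i k) * x k) - (y - \sum_k kA (c k) * x k).
  rewrite opprB addrC addrA subrK -sumrB; apply: eq_bigr => l _.
  by rewrite rmorphB mulrBl.
exact: JB.
Qed.

Section FunctionRing.
Variables (Fq : finFieldType) (F : fieldExtType {fraction {poly Fq}}).
Variables (A : comNzRingType) (iA : {rmorphism A -> F}) (inf : F -> int).
Hypothesis hA : regular_ring inf iA.

Lemma regular_ring_const :
  exists kA : {rmorphism Fq -> A}, forall c, iA (kA c) = constF F c.
Proof.
have [iA_inj regA] := hA.
have ex c : exists a, iA a = constF F c.
  apply/regA => w [hw _] _ nz; rewrite (@val_unity _ _ w hw _ #|Fq|.-1) //.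
    by rewrite -subn1 subn_gt0 finNzRing_gt1.
  have c0 : c != 0.
    by apply: contra_neq nz => ->; rewrite -const_morphE rmorph0.
  rewrite -const_morphE -rmorphXn -(rmorph1 (const_morph F)).
  congr (const_morph F _).
  apply: (mulfI c0); rewrite -exprS prednK ?mulr1 ?expf_card //.
  exact: ltnW (finNzRing_gt1 Fq).
have [k kE] := choice ex.
have k1 : k 1 = 1 by apply: iA_inj; rewrite kE -const_morphE !rmorph1.
have kB : {morph k : x y / x - y}.
  by move=> x y; apply: iA_inj; rewrite rmorphB !kE -!const_morphE rmorphB.
have kM : {morph k : x y / x * y}.
  by move=> x y; apply: iA_inj; rewrite rmorphM !kE -!const_morphE rmorphM.
pose kZ := GRing.isZmodMorphism.Build Fq A k kB.
pose kMM := GRing.isMonoidMorphism.Build Fq A k (conj k1 kM).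
pose kA : {rmorphism Fq -> A} := HB.pack k kZ kMM.
by exists kA.
Qed.

Lemma principal_card_quotient (a : A) : a != 0 ->
  exists d, card_quotient (fun x => exists b, x = b * a) (#|Fq| ^ d).
Proof.
move=> a0; have [kA kAE] := regular_ring_const; have [iA_inj _] := hA.
have [n nP] := polynomial_relation (iA a).
have a_reg : GRing.lreg a.
  move=> x y /(congr1 iA); rewrite !rmorphM => /mulfI xy; apply/iA_inj/xy.
  by rewrite -(rmorph0 iA) (inj_eq iA_inj).
apply: (@card_quotient_exp _ _ kA _ n).
  split=> [|x y [b ->] [c ->]|x y [b ->]].
  - by exists 0; rewrite mul0r.
  - by exists (b + c); rewrite mulrDl.
  - by exists (x * b); rewrite mulrA.
move=> x; have [c [c0 rel]] := nP (fun i => iA (x i)).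
have [|d [y [d0 dE]]] := @relation_modulo _ _ kA a n x c a_reg c0.
  apply: iA_inj; rewrite rmorph0 -rel rmorph_sum; apply: eq_bigr => i _.
  rewrite rmorphM -horner_map -map_poly_comp; congr (_.[_] * _).
  by apply: eq_map_poly => u /=; rewrite kAE.
by exists d; split=> //; exists y.
Qed.

End FunctionRing.

(** * Twisted polynomials *)

Lemma ltr_nMn2l (R : numDomainType) (x : R) m n :
  x < 0 -> (m < n)%N -> x *+ n < x *+ m.
Proof. by move=> x0 mn; rewrite -!(mulr_natr x) ltr_nM2l // ltr_nat. Qed.

Lemma ltr_pMn2l (R : numDomainType) (x : R) m n :
  0 < x -> (m < n)%N -> x *+ m < x *+ n.
Proof. by move=> x0 mn; rewrite -!(mulr_natr x) ltr_pM2l // ltr_nat. Qed.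

Section QPower.
Variables (Fq : finFieldType) (R : comNzRingType) (i : {rmorphism Fq -> R}).
Local Notation q := #|Fq|.

Lemma qpowerD n (x y : R) : (x + y) ^+ (q ^ n) = x ^+ (q ^ n) + y ^+ (q ^ n).
Proof.
have [p p_pr pchar] := finPcharP Fq.
have pR : p \in [pchar R]%R.
  by rewrite inE p_pr -(rmorph_nat i) (pcharf0 pchar) rmorph0 eqxx.
rewrite exprDn_pchar // (eq_pnat _ (pcharf_eq pR)) pnatX.
by have := pprimeChar_pgroup pchar; rewrite /pgroup cardsT => ->.
Qed.

Lemma qpower_natr n : (0 < n)%N -> (q ^ n)%:R = 0 :> R.
Proof.
have [p p_pr pchar] := finPcharP Fq; case: n => // n _.
have /p_natP[[|k] qE] : p.-nat q.
- by have := pprimeChar_pgroup pchar; rewrite /pgroup cardsT.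
- by have := finNzRing_gt1 Fq; rewrite qE.
rewrite expnS {1}qE expnS !natrM -(rmorph_nat i) (pcharf0 pchar).
by rewrite rmorph0 !mul0r.
Qed.

Lemma qpower_gt0 n : (0 < q ^ n)%N.
Proof. by rewrite expn_gt0 ltnW // finNzRing_gt1. Qed.

Lemma qpower0 n : 0 ^+ (q ^ n) = 0 :> R.
Proof. by rewrite expr0n eqn0Ngt qpower_gt0. Qed.

Lemma qpowerB n (x y : R) : (x - y) ^+ (q ^ n) = x ^+ (q ^ n) - y ^+ (q ^ n).
Proof. by apply/eqP; rewrite eq_sym subr_eq -qpowerD subrK. Qed.

Lemma qpower_sum n (I : Type) (r : seq I) (P : pred I) (x : I -> R) :
  (\sum_(j <- r | P j) x j) ^+ (q ^ n) = \sum_(j <- r | P j) x j ^+ (q ^ n).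
Proof. exact: (big_morph (fun u : R => u ^+ (q ^ n)) (qpowerD n) (qpower0 n)). Qed.

End QPower.

Section TwistedAction.
Variables (Fq : finFieldType) (K : fieldType) (iK : {rmorphism Fq -> K}).
Variables (Ks : fieldType) (jK : {rmorphism K -> Ks}).
Local Notation q := #|Fq|.
Local Notation act := (tact q jK).
Implicit Types (f g : {poly K}) (x y : Ks).

Lemma tact_wide n f x : (size f <= n)%N ->
  act f x = \sum_(i < n) jK f`_i * x ^+ (q ^ i).
Proof.
move=> fn; rewrite /tact (big_ord_widen n (fun i => jK f`_i * x ^+ (q ^ i))) //.
rewrite big_mkcond; apply: eq_bigr => i _; case: ltnP => // fi.
by rewrite nth_default // rmorph0 mul0r.
Qed.

Lemma tactD f x y : act f (x + y) = act f x + act f y.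
Proof.
rewrite -big_split; apply: eq_bigr => i _.
by rewrite (@qpowerD _ _ (jK \o iK)) mulrDr.
Qed.

Lemma tact0 f : act f 0 = 0.
Proof. by apply: (addIr (act f 0)); rewrite -tactD !add0r. Qed.

Lemma tactB f x y : act f (x - y) = act f x - act f y.
Proof. by apply/eqP; rewrite eq_sym subr_eq -tactD subrK. Qed.

Lemma tact_sum f (I : Type) (r : seq I) (P : pred I) (x : I -> Ks) :
  act f (\sum_(j <- r | P j) x j) = \sum_(j <- r | P j) act f (x j).
Proof. exact: (big_morph _ (tactD f) (tact0 f)). Qed.

Lemma tactM f g x : act (tmul q f g) x = act f (act g x).
Proof.
pose N := (size f + size g)%N.
pose G i j := jK (f`_i * g`_j ^+ (q ^ i)) * x ^+ (q ^ (i + j)).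
rewrite (@tact_wide N) ?size_poly //.
transitivity (\sum_(0 <= k < N) \sum_(0 <= i < N | (i <= k)%N) G i (k - i)%N).
  rewrite big_mkord; apply: eq_bigr => k _.
  rewrite coef_poly ltn_ord rmorph_sum big_distrl /=.
  rewrite big_mkord (big_ord_widen_cond N xpredT (fun i =>
    jK (f`_i * g`_(k - i) ^+ (q ^ i)) * x ^+ (q ^ k))) //=.
  by apply: eq_bigr => i ik; rewrite /G subnKC.
rewrite (exchange_big_dep_nat xpredT) //= [LHS]big_mkord.
rewrite (@tact_wide N f) ?leq_addr //.
apply: eq_bigr => i _; rewrite [in LHS]big_mkord.
rewrite /tact (@qpower_sum _ _ (jK \o iK)) big_distrr /=.
rewrite -(big_geq_mkord i N xpredT (fun k => G i (k - i)%N)).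
rewrite -{1}(add0n (nat_of_ord i)) big_addn big_mkord.
transitivity (\sum_(j < N - i) G i j).
  by apply: eq_bigr => j _; rewrite addnK.
case: (ltnP i (size f)) => fi; last first.
  by rewrite !big1 // => j _; rewrite /G nth_default // ?mul0r rmorph0 mul0r.
have gN : (size g <= N - i)%N by rewrite /N -addnBAC ?leq_addl // ltnW.
rewrite (big_ord_widen (N - i)
  (fun j => jK f`_i * (jK g`_j * x ^+ (q ^ j)) ^+ (q ^ i))) //.
rewrite [RHS]big_mkcond; apply: eq_bigr => j _; rewrite /G; case: ltnP => gj.
  by rewrite rmorphM rmorphXn exprMn -exprM -expnD addnC mulrA.
by rewrite (nth_default 0 gj) qpower0 mulr0 rmorph0 mul0r.
Qed.

Lemma tact_galois (sigma : {rmorphism Ks -> Ks}) f x :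
  galois_auto jK sigma -> sigma (act f x) = act f (sigma x).
Proof.
move=> [_ sK]; rewrite rmorph_sum; apply: eq_bigr => i _.
by rewrite rmorphM rmorphXn sK.
Qed.

Definition tpoly f : {poly K} := \sum_(i < size f) f`_i *: 'X^(q ^ i).

Lemma tpolyE f x : (map_poly jK (tpoly f)).[x] = act f x.
Proof.
rewrite rmorph_sum horner_sum; apply: eq_bigr => i _ /=.
by rewrite map_polyZ map_polyXn hornerZ hornerXn.
Qed.

Lemma tpoly_deriv f : (tpoly f)^`() = (f`_0)%:P.
Proof.
rewrite /tpoly; case sf : (size f) => [|n].
  by rewrite big_ord0 deriv0 nth_default ?sf.
rewrite big_ord_recl derivD expn0 derivZ derivX alg_polyC.
rewrite raddf_sum big1 ?addr0 // => i _.
by rewrite [LHS]derivZ derivXn -mulr_natr -[_%:R]polyC_natr (qpower_natr iK) //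
  polyC0 mulr0 scaler0.
Qed.

Lemma tpoly_sub_separable f (c : K) : f`_0 != 0 -> separable_poly (tpoly f - c%:P).
Proof.
move=> f0; rewrite unlock derivB derivC subr0 tpoly_deriv coprimep_sym.
by rewrite -alg_polyC coprimepZl // coprime1p.
Qed.

Lemma tact_surjective f : separable_closure jK -> f`_0 != 0 ->
  forall y : Ks, exists x, act f x = y.
Proof.
move=> hKs f0 y.
pose P := map_poly jK (tpoly f) - y%:P.
have sepP : separable_poly P.
  rewrite unlock derivB derivC subr0 deriv_map tpoly_deriv map_polyC.
  by rewrite coprimep_sym -alg_polyC coprimepZl ?fmorph_eq0 // coprime1p.
have P1 : (1 < size P)%N.
  rewrite ltnNge; apply/negP => /size1_polyC PC.
  have /eqP : P^`() = 0 by rewrite PC derivC.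
  rewrite derivB derivC subr0 deriv_map tpoly_deriv map_polyC polyC_eq0.
  by rewrite fmorph_eq0 (negbTE f0).
have [x /rootP] := sep_closed hKs sepP P1.
rewrite hornerD hornerN hornerC tpolyE => /eqP; rewrite subr_eq0 => /eqP xy.
by exists x.
Qed.

End TwistedAction.

Lemma qpower_exp_separable (Fq : finFieldType) (L : fieldType)
    (i : {rmorphism Fq -> L}) n :
  (0 < n)%N -> separable_poly ('X^(#|Fq| ^ n) - 'X : {poly L}).
Proof.
move=> n0; rewrite unlock derivB derivXn derivX -mulr_natr -[_%:R]polyC_natr.
rewrite (qpower_natr i) // polyC0 mulr0 sub0r coprimep_sym.
by rewrite -polyC1 -polyCN -alg_polyC coprimepZl ?oppr_eq0 ?oner_eq0 // coprime1p.
Qed.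

Record unit_ends (K : fieldType) (v : K -> int) (f : {poly K}) (N : nat) : Prop :=
  { unit_ends_int : forall i, vge v 0 f`_i;
    unit_ends0 : f`_0 != 0 /\ v f`_0 = 0;
    unit_endsN : f`_N != 0 /\ v f`_N = 0;
    unit_ends_deg : forall i, (N < i)%N -> f`_i = 0 }.

Section GoodReduction.
Variables (Fq : finFieldType) (K : fieldType) (iK : {rmorphism Fq -> K}).
Variables (v : K -> int) (Ks : fieldType) (jK : {rmorphism K -> Ks}).
Variable (vs : Ks -> rat).
Hypotheses (hv : valuation v) (hvs : extends_valuation jK v vs).
Variables (f : {poly K}) (N : nat).
Hypothesis hf : unit_ends v f N.
Local Notation q := #|Fq|.
Local Notation act := (tact q jK).
Implicit Types (x y : Ks).

Let hvs1 : valuation vs := hvs.1.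

Lemma vge_jK r c : vge v r c -> vge vs r%:~R (jK c).
Proof.
by rewrite /vge fmorph_eq0 => hc c0; rewrite hvs.2 // ler_int hc.
Qed.

Lemma unit_ends_size : size f = N.+1.
Proof.
apply/eqP; rewrite eqn_leq; apply/andP; split.
  by apply/leq_sizeP => i /(unit_ends_deg hf).
by rewrite ltnNge; apply/negP => /leq_sizeP/(_ N (leqnn _))/eqP;
  rewrite (negbTE (unit_endsN hf).1).
Qed.

Lemma tact_val_lt0 x : x != 0 -> vs x < 0 ->
  act f x != 0 /\ vs (act f x) = vs x *+ (q ^ N).
Proof.
move=> x0 x_lt0; rewrite (@tact_wide _ _ _ jK N.+1) ?unit_ends_size //.
have [fN0 fN] := unit_endsN hf.
have vN : vs (jK f`_N * x ^+ (q ^ N)) = vs x *+ (q ^ N).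
  by rewrite (valuationM hvs1) ?fmorph_eq0 ?expf_neq0 // hvs.2 // fN add0r valX.
rewrite -vN; apply: (sum_dom hvs1 (k := ord_max)
  (F := fun i : 'I_N.+1 => jK f`_i * x ^+ (q ^ i))) => /= [|i iN].
  by rewrite mulf_neq0 ?fmorph_eq0 ?expf_neq0.
rewrite vN; apply: (vge_gt (s := vs x *+ (q ^ i))).
  apply: ltr_nMn2l => //; rewrite ltn_exp2l ?finNzRing_gt1 //.
  by rewrite ltn_neqAle -ltnS ltn_ord andbT.
apply: vgeM0 => //; first exact: (vge_jK (@unit_ends_int _ _ _ _ hf i)).
exact: vgeX.
Qed.

Lemma tact_val_gt0 x : x != 0 -> 0 < vs x ->
  act f x != 0 /\ vs (act f x) = vs x.
Proof.
move=> x0 x_gt0; rewrite (@tact_wide _ _ _ jK N.+1) ?unit_ends_size //.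
have [f00 f0] := unit_ends0 hf.
have v0 : vs (jK f`_0 * x ^+ (q ^ 0)) = vs x.
  by rewrite (valuationM hvs1) ?fmorph_eq0 ?expf_neq0 // hvs.2 // f0 add0r expn0.
rewrite -[in RHS]v0; apply: (sum_dom hvs1 (k := ord0)
  (F := fun i : 'I_N.+1 => jK f`_i * x ^+ (q ^ i))) => /= [|i i0].
  by rewrite mulf_neq0 ?fmorph_eq0 ?expf_neq0.
rewrite v0; apply: (vge_gt (s := vs x *+ (q ^ i))).
  rewrite -[X in X < _]mulr1n; apply: ltr_pMn2l => //; rewrite -{1}(expn0 q).
  by rewrite ltn_exp2l ?finNzRing_gt1 // lt0n.
apply: vgeM0 => //; first exact: (vge_jK (@unit_ends_int _ _ _ _ hf i)).
exact: vgeX.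
Qed.

Lemma torsion_unit x : x != 0 -> act f x = 0 -> vs x = 0.
Proof.
move=> x0 fx; case: (ltrgtP (vs x) 0) => // hx.
  by have [] := tact_val_lt0 x0 hx; rewrite fx eqxx.
by have [] := tact_val_gt0 x0 hx; rewrite fx eqxx.
Qed.

Lemma inertia_fixes_torsion (sigma : {rmorphism Ks -> Ks}) x :
  inertia jK vs sigma -> act f x = 0 -> sigma x = x.
Proof.
move=> [gal inert] fx; have [->|x0] := eqVneq x 0; first by rewrite rmorph0.
apply/eqP; rewrite -subr_eq0; apply: contraT => d0.
have := inert x x0; rewrite (torsion_unit x0 fx) => /(_ (lexx _) d0).
rewrite (torsion_unit d0) ?ltxx // (tactB iK) -(tact_galois Fq _ _ gal) fx.
by rewrite rmorph0 subr0.
Qed.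

End GoodReduction.

Section InertiaContinuity.
Variables (K : fieldType) (v : K -> int) (Ks : fieldType).
Variables (jK : {rmorphism K -> Ks}) (vs : Ks -> rat).
Hypotheses (hv : normalized_valuation v) (hvs : extends_valuation jK v vs).

(* Up to a power and an element of [K], every element is a unit. *)
Lemma inertia_val (sigma : {rmorphism Ks -> Ks}) x :
  inertia jK vs sigma -> x != 0 -> vs (sigma x) = vs x.
Proof.
move=> [[_ sK] inert] x0.
have unit y : y != 0 -> vs y = 0 -> vs (sigma y) = 0.
  move=> y0 vy; have [] := @vgt_val _ _ _ hvs.1 y (sigma y) y0; last by rewrite vy.
  by rewrite vy -opprB => /=; apply: (vgtN hvs.1) => d0; apply: inert; rewrite ?vy.
have [pi [pi0 vpi]] := hv.2.
pose d := absz (denq (vs x)).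
have d0 : (0 < d)%N by rewrite absz_gt0 denq_neq0.
have vd : vs x *+ d = (numq (vs x))%:~R.
  rewrite -mulr_natr /d -[_%:R]/((Posz _)%:~R) absz_denq.
  by rewrite -[X in X * _]divq_num_den divfK // intr_eq0 denq_neq0.
pose c : K := pi ^ (- numq (vs x)).
have c0 : c != 0 by rewrite expfz_neq0.
have vc : v c = - numq (vs x).
  by rewrite (valXz hv.1) // vpi intz.
have u0 : x ^+ d * jK c != 0 by rewrite mulf_neq0 ?expf_neq0 ?fmorph_eq0.
have vsd y : y != 0 -> vs (y ^+ d * jK c) = vs y *+ d - vs x *+ d.
  move=> y0; rewrite (valuationM hvs.1) ?expf_neq0 ?fmorph_eq0 //.
  by rewrite (valX hvs.1) // hvs.2 // vc rmorphN /= vd.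
have := unit _ u0; rewrite vsd // subrr rmorphM rmorphXn /= sK vsd ?fmorph_eq0 //.
move=> /(_ erefl)/eqP; rewrite -mulrnBl mulrn_eq0 eqn0Ngt d0 subr_eq0 /=.
by move/eqP.
Qed.

Lemma analytic_inertia (e : Ks -> Ks) (sigma : {rmorphism Ks -> Ks}) x :
  analytic jK vs e -> inertia jK vs sigma -> sigma x = x -> sigma (e x) = e x.
Proof.
move=> [c cP] hs sx; apply/eqP; rewrite -subr_eq0; apply/eqP.
apply: (vge_eq0 (w := vs)) => r.
have [n /(_ n (leqnn n)) hn] := cP x r.
set S := \sum_(i < n) _ in hn.
have sS : sigma S = S.
  rewrite rmorph_sum; apply: eq_bigr => i _.
  by rewrite rmorphM rmorphXn sx hs.1.2.
have -> : sigma (e x) - e x = (S - e x) - sigma (S - e x).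
  by rewrite rmorphB sS; ring.
apply: (vgeB hvs.1) => //; move: hn; rewrite /vge fmorph_eq0 => hn d0.
by rewrite inertia_val // hn.
Qed.

End InertiaContinuity.

(** * The constant term of a uniformized Drinfeld module *)

Section AnalyticGrowth.
Variables (K : fieldType) (Ks : fieldType).
Variables (jK : {rmorphism K -> Ks}) (vs : Ks -> rat).
Hypothesis hvs : valuation vs.

Lemma finite_val_lower_bound (n : nat) (x : nat -> Ks) :
  exists2 C : rat, 0 <= C & forall i, (i < n)%N -> vge vs (- C) (x i).
Proof.
elim: n => [|n [C C0 IH]]; first by exists 0.
exists (C + `|vs (x n)|); first by rewrite addr_ge0.
move=> i; rewrite ltnS leq_eqVlt => /orP[/eqP->|/IH]; last first.
  by apply: vge_le; rewrite lerN2 lerDl.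
move=> _; have := lerNnormlW (lexx `|vs (x n)|); lra.
Qed.

Lemma analytic_growth (e : Ks -> Ks) :
  analytic jK vs e -> e 0 = 0 -> (exists x, e x != 0) ->
  exists (k : nat) (g B : rat), (0 < k)%N /\
    forall x, x != 0 -> B <= vs x -> e x != 0 /\ vs (e x) = g + vs x *+ k.
Proof.
move=> [c cP] e0 [x1 ex1].
have exk : exists k, c k != 0.
  apply: contrapT => nex; move/negP: ex1; apply; apply/eqP.
  apply: (vge_eq0 (w := vs)) => r; have [n /(_ n (leqnn n))] := cP x1 r.
  rewrite big1 ?sub0r; first by move=> /(vgeN hvs); rewrite opprK.
  move=> i _; case: (eqVneq (c i) 0) => [->|ci]; first by rewrite rmorph0 mul0r.
  by case: nex; exists i.
case: (ex_minnP exk) => k ck mink.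
have k0 : (0 < k)%N.
  case: k ck {mink} => // c0; move/negP: c0; case; rewrite -(fmorph_eq0 jK).
  apply/eqP/(vge_eq0 (w := vs)) => r.
  have [n /(_ n.+1 (leqnSn n))] := cP 0 r.
  rewrite big_ord_recl expr0 mulr1 big1 ?addr0 ?e0 ?subr0 //.
  by move=> i _; rewrite exprS mul0r mulr0.
have [C [C0 CP]] : exists C : rat, 0 <= C /\ forall i, vge vs (- C) (jK (c i)).
  have [n0 n0P] := cP 1 0.
  have [C C0 CP] := finite_val_lower_bound n0 (fun i => jK (c i)).
  exists C; split=> // i; case: (ltnP i n0) => [|ni]; first exact: CP.
  have -> : jK (c i) = (\sum_(l < i.+1) jK (c l) * 1 ^+ l - e 1) -
                       (\sum_(l < i) jK (c l) * 1 ^+ l - e 1).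
    by rewrite big_ord_recr /= expr1n mulr1; ring.
  apply: (vge_le (s := 0)); first by lra.
  by apply: vgeB => //; apply: n0P; rewrite // leqW.
set g := vs (jK (c k)); exists k, g, (`|g| + C + 1); split=> // x x0 xB.
set T := g + vs x *+ k.
have xg : g + C < vs x by have := ler_norm g; lra.
have x_gt0 : 0 < vs x by have := normr_ge0 g; lra.
have cxk : jK (c k) * x ^+ k != 0 by rewrite mulf_neq0 ?fmorph_eq0 ?expf_neq0.
have vcxk : vs (jK (c k) * x ^+ k) = T.
  by rewrite (valuationM hvs) ?fmorph_eq0 ?expf_neq0 // valX.
have [n0 n0P] := cP x (T + 1).
have /n0P : (n0 <= maxn n0 k.+1)%N by rewrite leq_maxl.
set n := maxn n0 k.+1; set S := \sum_(i < n) _ => Se.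
have kn : (k < n)%N by rewrite leq_maxr.
have [S0 vS] : S != 0 /\ vs S = T.
  rewrite -vcxk; apply: (sum_dom hvs (k := Ordinal kn)
    (F := fun i : 'I_n => jK (c i) * x ^+ i)) => //= i ik.
  rewrite vcxk; case: (ltnP i k) => ltik.
    have -> : c i = 0.
      by apply/eqP; apply: contraLR ltik => /mink; rewrite -leqNgt.
    by rewrite rmorph0 mul0r; apply: vgt0.
  have {ik}ltki : (k < i)%N by rewrite ltn_neqAle eq_sym ltik andbT.
  apply: (vge_gt (s := - C + vs x *+ i)); last by apply: vgeM => //; apply: vgeX.
  have : vs x *+ k.+1 <= vs x *+ i.
    by rewrite -!(mulr_natr (vs x)) ler_pM2l // ler_nat.
  by rewrite mulrSr /T; lra.
have -> : e x = S - (S - e x) by rewrite subKr.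
rewrite -vS; apply: (val_dom hvs) => //; rewrite vS; apply: (vgtN hvs).
by apply: vge_gt Se; rewrite ltrDl.
Qed.

End AnalyticGrowth.

Section Characteristic.
Variables (Fq : finFieldType) (K : fieldType) (v : K -> int).
Variables (Ks : fieldType) (jK : {rmorphism K -> Ks}) (vs : Ks -> rat).
Hypotheses (hv : normalized_valuation v) (hvs : extends_valuation jK v vs).
Local Notation q := #|Fq|.
Local Notation act := (tact q jK).

Lemma tact_small_val (f : {poly K}) : f`_0 != 0 -> v f`_0 = 0 ->
  exists B : rat, forall z, z != 0 -> B <= vs z -> act f z != 0 /\ vs (act f z) = vs z.
Proof.
move=> f00 f0.
have [C C0 CP] := finite_val_lower_bound vs (size f) (fun i => jK f`_i).
exists (C + 1) => z z0 zC.
have z_gt0 : 0 < vs z by lra.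
have sf : (0 < size f)%N.
  rewrite lt0n; apply: contra_neq f00 => /eqP.
  by rewrite size_poly_eq0 => /eqP->; rewrite coef0.
have v0 : vs (jK f`_0 * z ^+ (q ^ 0)) = vs z.
  by rewrite (valuationM hvs.1) ?fmorph_eq0 ?expf_neq0 // hvs.2 // f0 add0r expn0.
rewrite -[in RHS]v0; apply: (sum_dom hvs.1 (k := Ordinal sf)
  (F := fun i : 'I_(size f) => jK f`_i * z ^+ (q ^ i))) => /= [|i i0].
  by rewrite mulf_neq0 ?fmorph_eq0 ?expf_neq0.
rewrite v0; apply: (vge_gt (s := - C + vs z *+ (q ^ i))); last first.
  by apply: (vgeM hvs.1); [exact: CP | exact: (vgeX hvs.1)].
have : vs z *+ 2 <= vs z *+ (q ^ i).
  rewrite -!(mulr_natr (vs z)) ler_pM2l // ler_nat.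
  have i1 : (0 < i)%N by rewrite lt0n.
  apply: leq_trans (finNzRing_gt1 Fq) _; rewrite -{1}(expn1 q) leq_exp2l //.
  exact: finNzRing_gt1.
by rewrite mulr2n; lra.
Qed.

(* Near [0] the map [e] scales valuations affinely and [E_a] preserves them,
   whereas [D_a] would increase them if its constant term were not a unit. *)
Lemma uniformized_constant_unit (Da Ea : {poly K}) (e : Ks -> Ks) :
  analytic jK vs e -> e 0 = 0 -> (exists x, e x != 0) ->
  (forall x, e (act Da x) = act Ea (e x)) ->
  (forall i, vge v 0 Da`_i) -> Ea`_0 != 0 -> v Ea`_0 = 0 ->
  Da`_0 != 0 /\ v Da`_0 = 0.
Proof.
move=> an e0 ne eDE Dint E00 E0.
have [k [g [B [k0 eP]]]] := analytic_growth hvs.1 an e0 ne.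
have [B' EP] := tact_small_val E00 E0.
apply: contrapT => nD.
have D0 : vge v 1 Da`_0.
  move=> D00; rewrite -[1]add0r lezD1 lt_neqAle Dint // andbT eq_sym.
  by apply/eqP => vD; apply: nD.
have [pi [pi0 vpi]] := hv.2.
pose n := (Num.truncn (`|B| + `|B'| + `|g|)).+1.
have nB : `|B| + `|B'| + `|g| < n%:R by apply: truncnS_gt.
pose x := jK (pi ^+ n).
have x0 : x != 0 by rewrite fmorph_eq0 expf_neq0.
have vx : vs x = n%:R.
  by rewrite hvs.2 ?expf_neq0 // (valX hv.1) // vpi -[1 *+ n]/(n%:R) natz.
have B1 := ler_norm B; have B1' := ler_norm B'; have g1 := lerNnormlW (lexx `|g|).
have b0 := normr_ge0 B; have b0' := normr_ge0 B'; have g0 := normr_ge0 g.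
have xB : B <= vs x by rewrite vx; lra.
have [ex0 vex] := eP x x0 xB.
have exB : B' <= vs (e x).
  rewrite vex; have : vs x *+ 1 <= vs x *+ k.
    by rewrite -!(mulr_natr (vs x)) ler_wpM2l ?ler_nat // vx.
  by rewrite mulr1n vx; lra.
have [Ex0 vEx] := EP _ ex0 exB.
have Dx : vge vs (n%:R + 1) (act Da x).
  apply: (vge_sum hvs.1) => i _.
  have := vgeX hvs.1 (n := (q ^ i)%N) (@vge_refl _ _ vs x); rewrite vx => hx.
  case: (posnP i) => [i0|i_gt0].
    rewrite i0 addrC; apply: (vgeM hvs.1); last by move: hx; rewrite i0 expn0.
    exact: (vge_jK hvs D0).
  apply: (vgeM0 hvs.1); first exact: (vge_jK hvs (Dint i)).
  apply: vge_le hx; rewrite natr1 -mulrnA ler_nat -addn1.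
  apply: (@leq_trans (n * 2)%N); first by rewrite muln2 -addnn leq_add2l.
  rewrite leq_mul2l /=; apply: leq_trans (finNzRing_gt1 Fq) _.
  by rewrite -{1}(expn1 q) leq_exp2l // finNzRing_gt1.
have Dx0 : act Da x != 0.
  by apply: contra_neq Ex0 => Dx0; rewrite -eDE Dx0 e0.
have vDx := Dx Dx0.
have [|_] := eP _ Dx0; first by rewrite (le_trans _ vDx) //; lra.
rewrite eDE vEx vex => /addrI /eqP; rewrite eq_le => /andP[_].
rewrite leNgt => /negP; apply; rewrite -subr_gt0 -mulrnBl pmulrn_lgt0 // vx; lra.
Qed.

End Characteristic.

(** * Finite fields in the separable closure *)

Lemma vgt_root (R : realDomainType) (L : fieldType) (w : L -> R) (x : L) n :
  valuation w -> vgt w 0 (x ^+ n) -> (0 < n)%N -> vgt w 0 x.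
Proof.
move=> hw hx n0 x0; have := hx (expf_neq0 n x0); rewrite valX //.
by rewrite pmulrn_lgt0.
Qed.

Lemma root_product (R : idomainType) (p : {poly R}) (rs : seq R) (x : R) :
  p %= \prod_(r <- rs) ('X - r%:P) ->
  p.[x] = lead_coef p * \prod_(d <- [seq x - r | r <- rs]) d.
Proof.
move=> /eqp_eq; rewrite (eqP (monic_prod_XsubC _ _ _)) scale1r => {1}->.
by rewrite hornerZ horner_prod big_map; under eq_bigr => r _ do rewrite hornerXsubC.
Qed.

Section Frobenius.
Variables (Fq : finFieldType) (L : fieldType) (i : {rmorphism Fq -> L}).
Variable (w : L -> rat).
Hypothesis hw : valuation w.
Local Notation q := #|Fq|.
Implicit Types (x y : L).

Lemma frobenius_residue_iter d t x :
  vgt w 0 (x ^+ (q ^ d) - x) -> vgt w 0 (x ^+ (q ^ (d * t)) - x).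
Proof.
move=> hx; elim: t => [|t IH]; first by rewrite muln0 expn0 expr1 subrr; apply: vgt0.
have -> : x ^+ (q ^ (d * t.+1)) - x =
    (x ^+ (q ^ (d * t)) - x) ^+ (q ^ d) + (x ^+ (q ^ d) - x).
  by rewrite (qpowerB i) addrA subrK -exprM -expnD mulnS addnC.
apply: vgtD => // n0.
have y0 : x ^+ (q ^ (d * t)) - x != 0.
  by apply: contra_neq n0 => ->; rewrite qpower0.
by rewrite valX // pmulrn_lgt0 ?qpower_gt0 // IH.
Qed.

(* Pigeonhole on the Frobenius orbit of the residue of [x]. *)
Lemma frobenius_residue_periodic m (s : seq L) x :
  (forall n, exists2 y, y \in s & vgt w 0 (x ^+ (q ^ (m * n)) - y)) ->
  vgt w 0 (x ^+ (q ^ (m * (size s)`!)) - x).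
Proof.
move=> hs.
have ex n : exists k : 'I_(size s), vgt w 0 (x ^+ (q ^ (m * n)) - s`_k).
  have [y ys hy] := hs n.
  have lt : (index y s < size s)%N by rewrite index_mem.
  by exists (Ordinal lt); rewrite nth_index.
have [f fP] := choice ex.
have : ~~ injectiveb (fun k : 'I_(size s).+1 => f k).
  by apply/injectiveP => /leq_card; rewrite !card_ord ltnn.
case/injectivePn => a [b ab fab].
have [c [d [cd ds fcd]]] : exists c d : nat,
    [/\ (c < d)%N, (d <= size s)%N & f c = f d].
  have [||eab] := ltngtP a b; last by case/eqP: ab; apply: val_inj.
    by move=> lt; exists a, b; split; rewrite // -ltnS.
  by move=> lt; exists b, a; split; rewrite // -ltnS.
have per : vgt w 0 (x ^+ (q ^ (m * (d - c))) - x).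
  apply: (vgt_root (n := (q ^ (m * c))%N) hw); last exact: qpower_gt0.
  rewrite (qpowerB i) -exprM -expnD -mulnDr subnK 1?ltnW //.
  have -> : x ^+ (q ^ (m * d)) - x ^+ (q ^ (m * c)) =
    (x ^+ (q ^ (m * d)) - s`_(f d)) - (x ^+ (q ^ (m * c)) - s`_(f c)).
    by rewrite fcd; ring.
  exact: vgtB.
have dc : (0 < d - c <= size s)%N by rewrite subn_gt0 cd (leq_trans (leq_subr _ _)).
have /dvdnP[t ->] := dvdn_fact dc.
by rewrite (mulnC t) mulnA; apply: frobenius_residue_iter.
Qed.

End Frobenius.

Section Residues.
Variables (Fq : finFieldType) (K : fieldType) (iK : {rmorphism Fq -> K}).
Variables (v : K -> int) (Ks : fieldType) (jK : {rmorphism K -> Ks}).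
Variable (vs : Ks -> rat).
Hypotheses (hK : local_field v) (hvs : extends_valuation jK v vs).
Local Notation q := #|Fq|.
Local Notation act := (tact q jK).

Let hv : valuation v := (local_valuation hK).1.
Let hvs1 : valuation vs := hvs.1.
Let iKs : {rmorphism Fq -> Ks} := jK \o iK.

Lemma vgt_jK c : vge v 1 c -> vgt vs 0 (jK c).
Proof. by move=> /(vge_jK hvs); apply: vge_gt. Qed.

Lemma vge1_jK c : vgt vs 0 (jK c) -> vge v 1 c.
Proof.
move=> hc c0; have := hc; rewrite /vgt fmorph_eq0 hvs.2 // ltr0z => /(_ c0).
by rewrite -lezD1 add0r.
Qed.

Lemma residue_frobenius : exists2 m, (0 < m)%N &
  forall c, vge v 0 c -> vgt vs 0 (jK c ^+ (q ^ m) - jK c).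
Proof.
have [s sP] := local_residue_finite hK.
exists (size s)`!; first exact: fact_gt0.
move=> c hc; have := @frobenius_residue_periodic Fq Ks iKs vs hvs1 1 (map jK s) (jK c).
rewrite mul1n size_map; apply=> n.
have [y ys hy] := sP _ (vgeX0 hv (n := (q ^ (1 * n))%N) hc).
exists (jK y); first exact: map_f.
by rewrite -rmorphXn -rmorphB; apply: vgt_jK.
Qed.

Section Torsion.
Variables (f : {poly K}) (N : nat).
Hypothesis hf : unit_ends v f N.

Lemma torsion_int z : act f z = 0 -> vge vs 0 z.
Proof. by move=> fz z0; rewrite (torsion_unit hvs hf z0 fz). Qed.

Lemma tpoly_size : size (tpoly Fq f) = (q ^ N).+1 /\ lead_coef (tpoly Fq f) = f`_N.
Proof.
have [fN0 _] := unit_endsN hf.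
rewrite /tpoly (unit_ends_size hf) big_ord_recr /=.
have sN : size (f`_N *: 'X^(q ^ N)) = (q ^ N).+1.
  by rewrite size_scale // size_polyXn.
have lt : (size (\sum_(i < N) f`_i *: 'X^(q ^ i))%R < size (f`_N *: 'X^(q ^ N))%R)%N.
  rewrite sN ltnS; apply: (leq_trans (size_sum _ _ _)); apply/bigmax_leqP => i _.
  apply: (leq_trans (size_scale_leq _ _)); rewrite size_polyXn.
  by rewrite ltn_exp2l ?finNzRing_gt1.
by rewrite addrC size_polyDl // lead_coefDl // sN lead_coefZ lead_coefXn mulr1.
Qed.

Lemma torsion_frobenius : separable_closure jK ->
  exists2 m, (0 < m)%N &
    (forall c, vge v 0 c -> vgt vs 0 (jK c ^+ (q ^ m) - jK c)) /\
    (forall z, act f z = 0 -> vgt vs 0 (z ^+ (q ^ m) - z)).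
Proof.
move=> hKs; have [m m0 mP] := residue_frobenius.
have sep : separable_poly (map_poly jK (tpoly Fq f)).
  rewrite separable_map -[X in separable_poly X]subr0 -polyC0.
  exact: (tpoly_sub_separable iK _ (unit_ends0 hf).1).
have [rs rsE] := separable_splits (sep_closed hKs) sep.
have rsP r : r \in rs -> act f r = 0.
  move=> rrs; apply/eqP; rewrite -tpolyE -rootE (eqp_root rsE).
  by rewrite root_prod_XsubC.
exists (m * (size rs)`!)%N; first by rewrite muln_gt0 m0 fact_gt0.
split=> [c hc|z fz]; first by apply: (frobenius_residue_iter iKs) => //; apply: mP.
apply: (frobenius_residue_periodic iKs) => // n.
pose Q := (q ^ (m * n))%N.
have small : vgt vs 0 (act f (z ^+ Q)).
  have -> : act f (z ^+ Q) =
      \sum_(k < size f) (jK f`_k - jK f`_k ^+ Q) * (z ^+ Q) ^+ (q ^ k).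
    under eq_bigr => k _ do rewrite mulrBl.
    have fzQ : \sum_(k < size f) jK f`_k ^+ Q * (z ^+ Q) ^+ (q ^ k) = 0.
      transitivity (act f z ^+ Q); last by rewrite fz qpower0.
      rewrite (qpower_sum iKs); apply: eq_bigr => k _.
      by rewrite exprMn -!exprM mulnC.
    by rewrite sumrB fzQ subr0.
  apply: vgt_sum => // k _; rewrite mulrC; apply: vgtM0 => //.
    by do 2!apply: vgeX0 => //; exact: torsion_int.
  rewrite -opprB; apply: vgtN => //; apply: (frobenius_residue_iter iKs) => //.
  by apply: mP; exact: (unit_ends_int hf).
have := root_product (z ^+ Q) rsE.
rewrite tpolyE lead_coef_map (tpoly_size).2 => prodE.
have [fN0 fN] := unit_endsN hf.
have small' : vgt vs 0 (\prod_(d <- [seq z ^+ Q - r | r <- rs]) d).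
  move=> p0; have := small; rewrite prodE /vgt mulf_eq0 negb_or p0 fmorph_eq0 fN0.
  by move=> /(_ isT); rewrite valuationM ?fmorph_eq0 // hvs.2 // fN add0r.
have [|d /mapP[r rrs ->] hd] := vgt_prod hvs1 _ small'.
  move=> _ /mapP[r rrs ->]; apply: vgeB => //.
    by apply: vgeX0 => //; exact: torsion_int.
  by apply: torsion_int; apply: rsP.
by exists r.
Qed.

End Torsion.

Section FiniteField.
Variables (m : nat) (ts : seq Ks).
Hypotheses (m0 : (0 < m)%N).
Hypothesis tsE : 'X^(q ^ m) - 'X %= \prod_(t <- ts) ('X - t%:P).
Hypothesis frobK : forall c, vge v 0 c -> vgt vs 0 (jK c ^+ (q ^ m) - jK c).

Lemma fixed_field_exp_gt1 : (1 < q ^ m)%N.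
Proof. by rewrite -(exp1n m) ltn_exp2r ?finNzRing_gt1. Qed.

Lemma fixed_fieldP t : (t \in ts) = (t ^+ (q ^ m) == t).
Proof.
rewrite -root_prod_XsubC -(eqp_root tsE) rootE hornerD hornerN hornerXn hornerX.
by rewrite subr_eq0.
Qed.

Lemma fixed_field_val t : t \in ts -> t != 0 -> vs t = 0.
Proof.
rewrite fixed_fieldP => /eqP tt t0; have Q1 := fixed_field_exp_gt1.
apply: (val_unity hvs1 (n := (q ^ m).-1)); first by rewrite -ltnS prednK // ltnW.
by apply: (mulfI t0); rewrite -exprS prednK ?mulr1 // ltnW.
Qed.

Lemma fixed_field_int t : t \in ts -> vge vs 0 t.
Proof. by move=> tts t0; rewrite fixed_field_val. Qed.

Lemma fixed_field_approx z : vge vs 0 z -> vgt vs 0 (z ^+ (q ^ m) - z) ->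
  exists2 t, t \in ts & vgt vs 0 (z - t).
Proof.
move=> z_int hz; have := root_product z tsE.
have -> : lead_coef ('X^(q ^ m) - 'X : {poly Ks}) = 1.
  by rewrite lead_coefDl ?lead_coefXn // size_polyN size_polyX size_polyXn ltnS;
    exact: fixed_field_exp_gt1.
rewrite hornerD hornerN hornerXn hornerX mul1r => zE; rewrite zE in hz.
have [|d /mapP[t tts ->] hd] := vgt_prod hvs1 _ hz; last by exists t.
by move=> _ /mapP[t tts ->]; apply: vgeB => //; apply: fixed_field_int.
Qed.

(* The Teichmueller representative of [c] is the limit of its Frobenius powers. *)
Lemma teichmueller c : vge v 0 c ->
  exists t, jK t \in ts /\ vge v 1 (c - t).
Proof.
move=> hc.
have [t tts ht] := fixed_field_approx (vge_jK hvs hc) (frobK hc).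
pose u n := c ^+ (q ^ (m * n)).
have tn n : t ^+ (q ^ (m * n)) = t.
  elim: n => [|n IH]; first by rewrite muln0 expr1.
  by rewrite mulnS expnD mulnC exprM IH; apply/eqP; rewrite -fixed_fieldP.
have ut n : jK (u n) - t = (jK c - t) ^+ (q ^ (m * n)).
  by rewrite (qpowerB iKs) tn rmorphXn.
have conv r : exists n0, forall n, (n0 <= n)%N -> vge vs r (jK (u n) - t).
  have [d0|d0] := eqVneq (jK c - t) 0.
    by exists 0%N => n _; rewrite ut d0 qpower0; apply: vge0.
  have vd := ht d0; exists (Num.truncn (`|r| / vs (jK c - t))).+1 => n n0.
  rewrite ut => _; rewrite valX // -mulr_natl.
  have : `|r| / vs (jK c - t) < n%:R.
    by apply: lt_le_trans (truncnS_gt _) _; rewrite ler_nat.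
  rewrite ltr_pdivrMr // => lt; apply: le_trans (ler_norm r) _.
  apply: le_trans (ltW lt) _; rewrite ler_wpM2r ?ler_nat //; first exact: ltW.
  apply: leq_trans (ltnW (ltn_expl n (finNzRing_gt1 Fq))) _.
  by rewrite leq_exp2l ?finNzRing_gt1 // leq_pmull.
have [|l lP] := @local_complete _ _ hK u.
  move=> r; have [n0 n0P] := conv r%:~R; exists n0 => a b ha hb ab0.
  have := vgeB hvs1 (n0P a ha) (n0P b hb).
  have -> : jK (u a) - t - (jK (u b) - t) = jK (u a - u b).
    by rewrite rmorphB; ring.
  by rewrite /vge fmorph_eq0 => /(_ ab0); rewrite hvs.2 // ler_int.
have lt : jK l = t.
  apply/eqP; rewrite -subr_eq0; apply/eqP; apply: (vge_eq0 (w := vs)) => r.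
  have [n1 n1P] := conv r; have [n2 n2P] := lP (Num.ceil r).
  have -> : jK l - t = (jK (u (maxn n1 n2)) - t) - jK (u (maxn n1 n2) - l).
    by rewrite rmorphB; ring.
  apply: vgeB => //; first by apply: n1P; rewrite leq_maxl.
  apply: (vge_le (s := (Num.ceil r)%:~R)); first exact: ceil_ge.
  apply: (vge_jK hvs); apply: n2P.
  by rewrite leq_maxr.
exists l; rewrite lt; split=> //; apply: vge1_jK.
by rewrite rmorphB lt.
Qed.

Lemma unramified_val (n : nat) (c : 'I_n -> K) (t : 'I_n -> Ks) :
  (forall k, t k \in ts) -> \sum_k jK (c k) * t k != 0 ->
  exists l : int, vs (\sum_k jK (c k) * t k) = l%:~R.
Proof.
move=> tts; set z := \sum_k _ => z0.
have [pi [pi0 vpi]] := (local_valuation hK).2.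
suff H d (r : int) (b : 'I_n -> K) : (forall k, vge v r (b k)) ->
    z = \sum_k jK (b k) * t k -> vs z < (r + d%:Z)%:~R ->
    exists l : int, vs z = l%:~R.
  pose r : int := - \sum_k `|v (c k)|.
  have rP k : vge v r (c k).
    move=> _; rewrite lerNl; apply: le_trans (ler_norm _) _; rewrite normrN.
    by rewrite (bigD1 k) //= lerDl sumr_ge0.
  pose d := (Num.truncn (`|vs z - r%:~R|)).+1.
  apply: (H d r c) => //; rewrite rmorphD /= -ltrBlDl.
  by apply: le_lt_trans (ler_norm _) _; apply: truncnS_gt.
elim: d r b => [|d IH] r b hb zE.
  have zr : vge vs r%:~R z.
    rewrite zE; apply: vge_sum => // k _; rewrite -[r%:~R]addr0.
    by apply: vgeM => //; [apply: (vge_jK hvs) | apply: fixed_field_int].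
  by rewrite addr0 ltNge zr.
move=> lt; pose p := pi ^ r.
have p0 : p != 0 by rewrite expfz_neq0.
have vp : v p = r by rewrite valXz // vpi intz.
have b_int k : vge v 0 (b k / p).
  rewrite -(subrr r); apply: vgeM => // _.
  by rewrite valV // vp.
have [s sP] := choice (fun k => teichmueller (b_int k)).
pose th := \sum_k jK (s k) * t k.
have thts : th \in ts.
  rewrite fixed_fieldP; apply/eqP; rewrite (qpower_sum iKs).
  apply: eq_bigr => k _; rewrite exprMn; congr (_ * _); apply/eqP;
  by rewrite -fixed_fieldP // (sP k).1.
have restE : z = jK p * th + \sum_k jK (b k - p * s k) * t k.
  rewrite big_distrr -big_split zE; apply: eq_bigr => k _ /=.
  by rewrite rmorphB rmorphM; ring.
have rest k : vge v (r + 1) (b k - p * s k).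
  have -> : b k - p * s k = p * (b k / p - s k) by field.
  by apply: vgeM => //; [rewrite -{1}vp | apply: (sP k).2].
have rest_sum : vge vs (r + 1)%:~R (\sum_k jK (b k - p * s k) * t k).
  apply: vge_sum => // k _; rewrite -[(r + 1)%:~R]addr0.
  by apply: vgeM => //; [apply: (vge_jK hvs) | apply: fixed_field_int].
have [th0|th0] := eqVneq th 0.
  apply: (IH (r + 1) (fun k => b k - p * s k)) => //.
    by rewrite restE th0 mulr0 add0r.
  by move: lt; rewrite -addn1 PoszD -addrA [1 + _]addrC.
have pth0 : jK p * th != 0 by rewrite mulf_neq0 ?fmorph_eq0.
have vpth : vs (jK p * th) = r%:~R.
  by rewrite valuationM ?fmorph_eq0 // hvs.2 // vp fixed_field_val ?addr0.
exists r; rewrite restE -vpth; apply: (val_dom hvs1 pth0 _).2.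
by rewrite vpth; apply: vge_gt rest_sum; rewrite ltr_int ltrDl.
Qed.

Section Approximation.
Variables (f : {poly K}) (N : nat).
Hypothesis hf : unit_ends v f N.

Lemma tact_linear_approx (r : rat) z : 0 <= r -> vge vs r z ->
  vge vs (r *+ q) (act f z - jK f`_0 * z).
Proof.
move=> r0 hz; rewrite (@tact_wide _ _ _ jK N.+1) ?(unit_ends_size hf) //.
rewrite big_ord_recl expn0 expr1 addrC addKr; apply: vge_sum => // k _.
apply: vgeM0 => //; first exact: (vge_jK hvs (@unit_ends_int _ _ _ _ hf _)).
apply: vge_le (vgeX hvs1 hz).
rewrite -!(mulr_natr r) ler_wpM2l // ler_nat /= -{1}(expn1 q).
by rewrite leq_exp2l ?finNzRing_gt1.
Qed.

(* Newton iteration from the nearest element of the finite field. *)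
Lemma torsion_approx (S : Ks -> Prop) z r :
  subring_pred S -> (forall c, S (jK c)) -> (forall t, t \in ts -> S t) ->
  vgt vs 0 (z ^+ (q ^ m) - z) -> act f z = 0 ->
  exists2 y, S y & vge vs r (z - y).
Proof.
move=> hS SK St zq fz.
have [t tts] := fixed_field_approx (torsion_int hf fz) zq; set d := z - t => hd.
have [d0|d0] := eqVneq d 0.
  by exists t; [exact: St | rewrite -/d d0; apply: vge0].
have {}hd := hd d0.
have [f00 f0] := unit_ends0 hf.
have SM x y : S x -> S y -> S (x * y) by case: hS => _ _; apply.
have SB x y : S x -> S y -> S (x - y) by case: hS => _ H _; apply: H.
have Sact y : S y -> S (act f y).
  move=> Sy; apply: subring_pred_sum => // k _.
  by apply: (SM) => //; apply: subring_predX.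
have dE : act f d = - act f t by rewrite (tactB iK) fz sub0r.
have [y Sy hy] : exists2 y, S y &
    vge vs (vs d *+ (q ^ (Num.truncn (`|r| / vs d)).+1)) (d - y).
  elim: (Num.truncn _).+1 => [|n [y Sy hy]].
    by exists 0; [exact: subring_pred0 | rewrite subr0].
  exists (y - jK (f`_0)^-1 * (act f y - act f d)).
    apply: (SB) => //; apply: (SM) => //; apply: (SB); first exact: Sact.
    by rewrite dE -sub0r; apply: (SB); [exact: subring_pred0 | exact/Sact/St].
  have -> : d - (y - jK (f`_0)^-1 * (act f y - act f d)) =
      - (jK (f`_0)^-1 * (act f (d - y) - jK f`_0 * (d - y))).
    have gh : jK (f`_0)^-1 * jK f`_0 = 1 by rewrite -rmorphM mulVf // rmorph1.
    rewrite (tactB iK jK f d y) [in RHS]mulrBr [in RHS](mulrA _ (jK f`_0)).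
    by rewrite gh mul1r; ring.
  apply: vgeN => //; apply: vgeM0 => //.
    by apply: (vge_jK hvs (r := 0)) => _; rewrite valV // f0 oppr0.
  rewrite expnS mulnC mulrnA; apply: tact_linear_approx => //.
  by rewrite mulrn_wge0 // ltW.
exists (t + y); first exact: subring_predD (St t tts) Sy.
have -> : z - (t + y) = d - y by rewrite /d; ring.
apply: vge_le hy; rewrite -mulr_natl; apply: le_trans (ler_norm r) _.
rewrite -ler_pdivrMr //; apply: le_trans (ltW (truncnS_gt _)) _.
by rewrite ler_nat ltnW // ltn_expl // finNzRing_gt1.
Qed.

End Approximation.
End FiniteField.
End Residues.

(** * Ramification of division fields *)

Section LowerRamification.
Variables (L : fieldType) (w : L -> int) (g : {rmorphism L -> L}) (i : int).
Hypotheses (hw : normalized_valuation w) (i1 : 1 <= i).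
Hypothesis hg : forall x, vge w 0 x -> vge w (i + 1) (g x - x).

(* Writing [x = pi^n u] with [u] a unit, both [g pi / pi] and [g u / u] are
   congruent to [1] modulo [pi^i]; the lemma passes to [x^-1], where [n > 0]. *)
Lemma lower_ram_val_lt0 x : x != 0 -> w x < 0 -> g x - x != 0 ->
  i + w x <= w (g x - x).
Proof.
move=> x0 x_lt0 gx; have [hv [pi [pi0 vpi]]] := hw.
pose y := x^-1; have y0 : y != 0 by rewrite invr_neq0.
have vy : w y = - w x by rewrite valV.
pose M := absz (w y).
have wyM : w y = M%:Z by rewrite /M; lia.
have M0 : (0 < M)%N by lia.
have piX n : w (pi ^+ n) = n%:Z by rewrite valX // vpi natz.
pose u := y / pi ^+ M.
have u0 : u != 0 by rewrite mulf_neq0 ?invr_neq0 ?expf_neq0.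
have vu : w u = 0.
  by rewrite valuationM ?invr_neq0 ?expf_neq0 // valV ?expf_neq0 // piX wyM subrr.
have yE : y = pi ^+ M * u by rewrite mulrC divfK ?expf_neq0.
have hpi : vge w (i + 1) (g pi - pi) by apply: hg => _; rewrite vpi.
have gpi0 : g pi != 0 by rewrite fmorph_eq0.
have vgpi : w (g pi) = 1.
  rewrite -vpi; have [] := @vgt_val _ _ _ hv pi (g pi) pi0; last by [].
  by rewrite vpi -opprB; apply: vgtN => //; apply: vge_gt hpi; lia.
have hy : vge w (i + M%:Z) (g y - y).
  have -> : g y - y = g pi ^+ M * (g u - u) + u * (g pi ^+ M - pi ^+ M).
    by rewrite yE rmorphM rmorphXn; ring.
  apply: vgeD => //.
    rewrite addrC; apply: vgeM => //.
      by move=> _; rewrite valX // vgpi natz.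
    by apply: (vge_le (s := i + 1)); [lia | apply: hg => _; rewrite vu].
  rewrite -[i + _]add0r; apply: vgeM => //; first by move=> _; rewrite vu.
  have -> : i + M%:Z = (i + 1) + M.-1%:Z by lia.
  rewrite subrXX; apply: vgeM => //; apply: vge_sum => // k _.
  have -> : M.-1%:Z = (M - k.+1)%N%:Z + k%:Z by have := ltn_ord k; lia.
  apply: vgeM => // _; last by rewrite piX.
  by rewrite valX // vgpi natz; lia.
have [gy0 vgy] : g y != 0 /\ w (g y) = w y.
  apply: (vgt_val hv y0); rewrite -opprB; apply: vgtN => //.
  by apply: vge_gt hy; rewrite wyM; lia.
have gxE : g x - x = (y - g y) / (y * g y).
  by rewrite /y fmorphV; field; rewrite fmorph_eq0 x0 oner_eq0.
have d0 : y - g y != 0 by apply: contra_neq gx => d; rewrite gxE d mul0r.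
rewrite gxE valuationM ?invr_neq0 ?mulf_neq0 // valV ?mulf_neq0 //.
rewrite valuationM // vgy.
have := hy; rewrite -opprB /vge oppr_eq0 => /(_ d0); rewrite valN // => h.
have wx : w x = - M%:Z by rewrite -wyM vy opprK.
by rewrite wx wyM; move: (w _) h => W h; lia.
Qed.

End LowerRamification.

Lemma herbrand_phi_le (K : fieldType) (L : splittingFieldType K) (w : L -> int)
  (u : rat) : 0 <= u -> herbrand_phi w u <= u.
Proof.
move=> u0; set k := Num.truncn u.
have ku : k%:R <= u by rewrite truncn_le.
have mono (n : nat) : (#|lower_ram w n%:Z| <= #|lower_ram w 0|)%N.
  apply: subset_leq_card; apply/subsetP => g; rewrite !inE => /andP[-> /asboolP hg].
  by apply/asboolP => x /hg; apply: vge_le; lia.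
have G0 : 0 < #|lower_ram w 0|%:R :> rat.
  rewrite ltr0n; apply/card_gt0P; exists 1%g; rewrite inE fingroup.group1.
  by apply/asboolP => x _; rewrite gal_id subrr; apply: vge0.
rewrite /herbrand_phi -/k ler_pdivrMr //.
have -> : u * #|lower_ram w 0|%:R =
    k%:R * #|lower_ram w 0|%:R + (u - k%:R) * #|lower_ram w 0|%:R by ring.
apply: lerD; last by rewrite ler_wpM2l ?subr_ge0 // ler_nat.
have -> : k%:R * #|lower_ram w 0|%:R =
    \sum_(1 <= i < k.+1) #|lower_ram w 0|%:R :> rat.
  by rewrite sumr_const_nat subn1 mulr_natl.
by apply: ler_sum => i _; rewrite ler_nat.
Qed.

Section Splitting.
Variables (Fq : finFieldType) (K : fieldType) (iK : {rmorphism Fq -> K}).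
Variables (v : K -> int) (Ks : fieldType) (jK : {rmorphism K -> Ks}).
Variable (vs : Ks -> rat).
Hypotheses (hK : local_field v) (hKs : separable_closure jK).
Hypothesis hvs : extends_valuation jK v vs.
Variables (f : {poly K}) (N : nat).
Hypothesis hf : unit_ends v f N.
Local Notation q := #|Fq|.
Local Notation act := (tact q jK).

(* [L] is generated by the torsion, which lies in the closure of an unramified
   extension [K'] of [K], by a finite field, and by [x], which has degree at
   most [q^N] over [K']. *)
Lemma division_field_ramification (x : Ks) (c : K) : act f x = jK c ->
  exists (L : splittingFieldType K) (j : {rmorphism L -> Ks}),
    [/\ galois 1 {:L}, forall a, j a%:A = jK a, exists y, j y = x
      & forall (e : nat) z, z != 0 -> e%:R * vs (j z) = 1 -> (e <= q ^ N)%N].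
Proof.
move=> fx.
have [m m0 [frobK frobT]] := torsion_frobenius iK hK hvs hf hKs.
pose iKs : {rmorphism Fq -> Ks} := jK \o iK.
pose p1 : {poly K} := tpoly Fq f - c%:P.
pose p2 : {poly K} := 'X^(q ^ m) - 'X.
have sep1 : separable_poly p1 := tpoly_sub_separable iK c (unit_ends0 hf).1.
have sep2 : separable_poly p2 := qpower_exp_separable iK m0.
have p2E : map_poly jK p2 = 'X^(q ^ m) - 'X.
  by rewrite rmorphB /= map_polyXn map_polyX.
have [xs xsE] : exists rs, map_poly jK p1 %= \prod_(r <- rs) ('X - r%:P).
  by apply: (separable_splits (sep_closed hKs)); rewrite separable_map.
have [ts tsE] : exists rs, map_poly jK p2 %= \prod_(r <- rs) ('X - r%:P).
  by apply: (separable_splits (sep_closed hKs)); rewrite separable_map.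
have xsP r : (r \in xs) = (act f r == jK c).
  rewrite -root_prod_XsubC -(eqp_root xsE) rootE rmorphB hornerD hornerN /=.
  by rewrite map_polyC hornerC tpolyE subr_eq0.
have tsE' := tsE; rewrite p2E in tsE'.
have p0 : p1 * p2 != 0 by rewrite mulf_neq0 // separable_poly_neq0.
have [|L [j [gal jE [ls jls] jS]]] :=
    @splitting_subextension K Ks jK hKs (p1 * p2) (xs ++ ts) p0.
  rewrite rmorphM big_cat; apply: eqp_trans (eqp_mulr _ xsE) _.
  exact: eqp_mull.
have inj_j y z : j y = j z -> y = z by apply: fmorph_inj.
have xxs : x \in xs by rewrite xsP fx.
have [xL xLE] : exists y, j y = x.
  have : x \in map j ls by rewrite jls mem_cat xxs.
  by case/mapP => y _ ->; exists y.
exists L, j; split=> //; first by exists xL.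
move=> e z0 z00 ez0.
pose tl := [seq y <- ls | j y \in ts].
have tlP y : (y \in tl) = (j y \in ts).
  rewrite mem_filter andbC; case: (boolP (j y \in ts)) => jy; rewrite ?andbF //.
  have : j y \in map j ls by rewrite jls mem_cat jy orbT.
  by case/mapP => z zls /inj_j->; rewrite zls.
have tlQ y : (y \in tl) = (y ^+ (q ^ m) == y).
  by rewrite tlP (fixed_fieldP tsE') -rmorphXn (inj_eq (@inj_j)).
have aK' : is_aspace <<tl>>%VS.
  rewrite /is_aspace has_algid1 /=; last by apply: memv_span; rewrite tlQ expr1n.
  apply/prodvP => a b.
  rewrite -[tl]/(in_tuple tl : seq L) => /coord_span-> /coord_span->.
  rewrite big_distrl; apply: memv_suml => k _.
  rewrite big_distrr; apply: memv_suml => l _ /=.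
  rewrite -scalerAl -scalerAr !memvZ // memv_span // tlQ exprMn.
  have nth_tl n : (n < size tl)%N -> tl`_n ^+ (q ^ m) = tl`_n.
    by move=> lt; apply/eqP; rewrite -tlQ mem_nth.
  by rewrite !nth_tl.
pose K' : {subfield L} := ASpace aK'.
have K'_val a : a \in K' -> a != 0 -> exists l : int, vs (j a) = l%:~R.
  rewrite -[K' : {vspace L}]/(<<in_tuple tl>>)%VS => /coord_span aE a0.
  have jaE : j a = \sum_(k < size tl) jK (coord (in_tuple tl) k a) * j tl`_k.
    rewrite {1}aE rmorph_sum; apply: eq_bigr => k _ /=.
    by rewrite -mulr_algl rmorphM jE.
  have ja0 : j a != 0 by rewrite fmorph_eq0.
  rewrite jaE in ja0 *.
  apply: (unramified_val iK hK hvs m0 tsE' frobK) => // k.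
  by rewrite -tlP mem_nth.
pose E := <<K'; xL>>%AS.
pose S z := exists2 y, y \in E & j y = z.
have hS : subring_pred S.
  split; first by exists 1; rewrite ?rmorph1 // mem1v.
    by move=> _ _ [a aE <-] [b bE <-]; exists (a - b); rewrite ?rmorphB // rpredB.
  by move=> _ _ [a aE <-] [b bE <-]; exists (a * b); rewrite ?rmorphM // rpredM.
have SK a : S (jK a) by exists a%:A; rewrite ?jE // rpredZ // mem1v.
have St t : t \in ts -> S t.
  move=> tts; have : t \in map j ls by rewrite jls mem_cat tts orbT.
  case/mapP => y yls tE; exists y => //; apply: subvP_adjoin.
  by apply: memv_span; rewrite tlP -tE.
have Sx : S x by exists xL; rewrite // memv_adjoin.
have hvs1 := hvs.1.
pose dense z := forall r, exists2 y, S y & vge vs r (z - y).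
have S_dense z : S z -> dense z.
  by move=> Sz r; exists z; rewrite // subrr; apply: vge0.
have dense_ring : subring_pred dense.
  have [S1 SB SM] := hS; split=> [|a b ha hb r|a b ha hb r]; first exact: S_dense.
    have [a' Sa' haa'] := ha r; have [b' Sb' hbb'] := hb r.
    exists (a' - b'); first exact: SB.
    have -> : a - b - (a' - b') = (a - a') - (b - b') by ring.
    exact: vgeB.
  have [b' Sb' hbb'] := hb (r - vs a); have [a' Sa' haa'] := ha (r - vs b').
  exists (a' * b'); first exact: SM.
  have -> : a * b - a' * b' = a * (b - b') + (a - a') * b' by ring.
  apply: vgeD => //.
    by rewrite -[r](subrK (vs a)) addrC; apply: vgeM.
  by rewrite -[r](subrK (vs b')); apply: vgeM.
have jz_dense : dense (j z0).
  apply: jS => // [a|y]; first exact/S_dense.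
  rewrite mem_cat => /orP[|/St/S_dense//].
  rewrite xsP => /eqP fy; rewrite -[y](subrK x).
  apply: (subring_predD dense_ring); last exact: S_dense.
  have tor : act f (y - x) = 0 by rewrite (tactB iK) fy fx subrr.
  by move=> r; apply: (torsion_approx iK hK hvs m0 tsE' hf) => //; apply: frobT.
have jz0 : j z0 != 0 by rewrite fmorph_eq0.
have e0 : e != 0%N by apply: contra_eq_neq ez0 => ->; rewrite mul0r eq_sym oner_eq0.
have eQ : e%:R != 0 :> rat by rewrite pnatr_eq0.
have [_ [z zE <-] hz] := jz_dense (vs (j z0) + 1).
have [jz vz] : j z != 0 /\ vs (j z) = vs (j z0).
  by apply: (vgt_val hvs1 jz0); apply: vge_gt hz; rewrite ltrDl.
have {vz} vz : vs (j z) = e%:R^-1.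
  by rewrite vz -[LHS](mulKf eQ) ez0 mulr1.
have sub_zx : (<<K'; z>> <= E)%VS by apply/FadjoinP; rewrite subv_adjoin zE.
have deg_z : (adjoin_degree K' z <= adjoin_degree K' xL)%N.
  have := dimvS sub_zx; rewrite !dim_Fadjoin leq_pmul2r //.
  by rewrite adim_gt0.
have deg_x : (adjoin_degree K' xL <= q ^ N)%N.
  rewrite -ltnS -size_minPoly.
  have p1_size : size p1 = (q ^ N).+1.
    rewrite size_polyDl (tpoly_size _ hf).1 // size_polyN.
    by apply: leq_ltn_trans (size_polyC_leq1 _) _; rewrite ltnS qpower_gt0.
  rewrite -p1_size -(size_map_poly (in_alg L)); apply: dvdp_leq.
    by rewrite map_poly_eq0 separable_poly_neq0.
  apply: minPoly_dvdp.
    by apply/polyOverP => k; rewrite coef_map /= memvZ // (mem1v K').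
  rewrite -(fmorph_root j) -map_poly_comp (eq_map_poly jE) xLE.
  by rewrite rootE rmorphB hornerD hornerN /= map_polyC hornerC tpolyE fx subrr.
apply: leq_trans (leq_trans deg_z deg_x); rewrite leqNgt; apply/negP => lt_e.
have := minPolyxx K' z; set d := adjoin_degree K' z in lt_e *.
move/(congr1 j)/eqP; rewrite rmorph0 horner_coef size_minPoly rmorph_sum.
apply/negP; have K'c k : (minPoly K' z)`_k \in K' by apply/polyOverP/minPolyOver.
have term_val (k : 'I_d.+1) : j ((minPoly K' z)`_k * z ^+ k) != 0 ->
    exists l : int, vs (j ((minPoly K' z)`_k * z ^+ k)) = l%:~R + k%:R / e%:R.
  rewrite fmorph_eq0 mulf_eq0 negb_or => /andP[c0 zk0].
  have [l lE] := K'_val _ (K'c k) c0; exists l.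
  rewrite rmorphM rmorphXn valuationM ?fmorph_eq0 ?expf_neq0 // lE valX // vz.
  by rewrite mulr_natl.
apply: (sum_distinct_val hvs1 (k := ord_max)) => /= [|k l k0 l0].
  have -> : (minPoly K' z)`_d = 1.
    have := monic_minPoly K' z; rewrite monicE lead_coefE size_minPoly.
    by move/eqP.
  by rewrite mul1r rmorphXn expf_neq0.
have [a ->] := term_val k k0; have [b ->] := term_val l l0.
move=> /(congr1 (fun r => r * e%:R)); rewrite !mulrDl !divfK // => kl.
have {}kl : a * e%:Z + k%:Z = b * e%:Z + l%:Z.
  by apply/eqP; rewrite -(eqr_int rat) !rmorphD !rmorphM /=; apply/eqP.
apply: ord_inj; have := ltn_ord k; have := ltn_ord l; rewrite !ltnS => ld kd.
have ke : (k < e)%N by apply: leq_ltn_trans lt_e.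
have le : (l < e)%N by apply: leq_ltn_trans lt_e.
have step (a1 b1 : int) : a1 < b1 -> a1 * e%:Z + e%:Z <= b1 * e%:Z.
  by move=> ab; rewrite -[X in _ + X]mul1r -mulrDl ler_wpM2r // lezD1.
have ab : a = b by case: (ltgtP a b) => // /step; clear -kl ke le; lia.
by move: kl; rewrite ab => /addrI [].
Qed.

End Splitting.

(** * The monodromy representation *)

Lemma upper_ramification_fixes (Fq : finFieldType) (K : fieldType)
    (iK : {rmorphism Fq -> K}) (v : K -> int) (Ks : fieldType)
    (jK : {rmorphism K -> Ks}) (vs : Ks -> rat) (f : {poly K}) (N : nat)
    (H : nat) (sigma : {rmorphism Ks -> Ks}) (x : Ks) (c : K) :
  local_field v -> separable_closure jK -> extends_valuation jK v vs ->
  unit_ends v f N -> inertia_upper jK vs H.+1%:R sigma ->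
  tact #|Fq| jK f x = jK c -> (height v c <= H)%N -> sigma x = x.
Proof.
move=> hK hKs hvs hf [inert ram] fx cH.
apply/eqP; rewrite -subr_eq0; apply: contraT => sx.
have [L [j [gal jE [y jy] eN]]] := division_field_ramification iK hK hKs hvs hf fx.
have [w [e [g [hw [e0 we] [u [u0 phiu]] gram gj]]]] := ram L j gal jE.
pose i := Num.ceil u.
have Hi : H.+1%:Z <= i.
  rewrite -(ler_int rat) /=; apply: le_trans (ceil_ge u).
  by have := herbrand_phi_le w u0; rewrite phiu.
have x0 : x != 0 by apply: contra_neq sx => ->; rewrite rmorph0 subrr.
have y0 : y != 0 by rewrite -(fmorph_eq0 j) jy.
have gy : j (g y - y) = sigma x - x by rewrite rmorphB -gj jy.
have gy0 : g y - y != 0 by rewrite -(fmorph_eq0 j) gy.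
have fz : tact #|Fq| jK f (sigma x - x) = 0.
  rewrite (tactB iK) -(tact_galois Fq _ _ inert.1) fx inert.1.2.
  by rewrite subrr.
have wgy : w (g y - y) = 0.
  apply/eqP; rewrite -(eqr_int rat) we // gy (torsion_unit hvs hf sx fz).
  by rewrite mulr0.
have x_lt0 : vs x < 0.
  rewrite ltNge; apply/negP => x_ge0; have := inert.2 x x0 x_ge0 sx.
  by rewrite (torsion_unit hvs hf sx fz) ltxx.
have [fx0 vfx] := tact_val_lt0 Fq hvs hf x0 x_lt0.
have c0 : c != 0 by rewrite -(fmorph_eq0 jK) -fx.
have vc : (v c)%:~R = vs x *+ #|Fq| ^ N by rewrite -vfx fx hvs.2.
have wy : (w y)%:~R = e%:R * vs x by rewrite we // jy.
have wy_lt0 : w y < 0.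
  by rewrite -(ltr_int rat) wy pmulr_rlt0 ?ltr0n.
have eQ : (e <= #|Fq| ^ N)%N.
  have [pi [pi0 vpi]] := hw.2.
  by apply: (eN e pi pi0); rewrite -we // vpi.
have vcH : - H%:Z <= v c.
  by move: cH; rewrite /height (negbTE c0) lerNl; move: (v c) => V; clear; lia.
have wyH : - H%:Z <= w y.
  rewrite -(ler_int rat) wy; apply: (@le_trans _ _ (v c)%:~R).
    by rewrite ler_int.
  by rewrite vc -(mulr_natl (vs x)); apply: ler_wnM2r; rewrite ?ler_nat // ltW.
have := gram; rewrite inE => /andP[_ /asboolP hg].
have i1 : 1 <= i by apply: le_trans Hi.
have := @lower_ram_val_lt0 L w g i hw i1 hg y y0 wy_lt0 gy0.
by rewrite wgy; move: (w y) i Hi wyH {i1}; clear; lia.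
Qed.

Section Uniformization.
Variables (Fq : finFieldType) (K : fieldType) (iK : {rmorphism Fq -> K}).
Variables (v : K -> int) (hK : local_field v).
Variables (Ks : fieldType) (jK : {rmorphism K -> Ks}).
Hypothesis hKs : separable_closure jK.
Variables (vs : Ks -> rat) (hvs : extends_valuation jK v vs).
Variables (F : fieldExtType {fraction {poly Fq}}) (inf : F -> int).
Variables (A : comNzRingType) (iA : {rmorphism A -> F}).
Hypothesis hA : regular_ring inf iA.
Variables (E D : A -> {poly K}) (Lam : Ks -> Prop) (e : Ks -> Ks).
Hypothesis hE : drinfeld_module iK iA E.
Hypothesis hchar : finite_residual_char v E.
Hypothesis hstable : tate_uniformization iK iA jK vs v E D Lam e.
Local Notation act := (tact #|Fq| jK).

Lemma uniformization_unit_ends a :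
  ~ residual_char v E a -> exists N, unit_ends v (D a) N.
Proof.
move=> a_res; rewrite /residual_char /drinfeld_char in a_res.
have E00 : (E a)`_0 != 0 by apply: contra_notN a_res => /eqP->; apply: vge0.
have E0 : v (E a)`_0 = 0.
  have := hchar E00; rewrite /drinfeld_char => E_ge0.
  apply/eqP; rewrite eq_le E_ge0 andbT leNgt; apply/negP => lt.
  by apply: a_res => _; lia.
have a0 : a != 0.
  apply: contra_neq E00 => ->; have := tau_homD hE.1 0 0.
  by rewrite addr0 -{1}[E 0]addr0 => /addrI<-; rewrite coef0.
have [d dP] := principal_card_quotient hA a0.
have [tauD intD [r [_ /(_ a d a0 dP)[_ D_deg] /(_ a d a0 dP)[D_lead _]]]] :=
  tate_reduction hstable.
have e0 : e 0 = 0.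
  by apply: (addIr (e 0)); rewrite -(tate_expD hstable) !add0r.
have ne : exists x, e x != 0.
  have [x xE] := tate_surjective hstable 1.
  by exists x; rewrite xE oner_neq0.
have intDa i : vge v 0 (D a)`_i by apply: intD.
exists (r * d)%N; split=> //.
  exact: (uniformized_constant_unit (local_valuation hK) hvs
    (tate_analytic hstable) e0 ne (tate_expA hstable a) intDa E00 E0).
have D0 : (D a)`_(r * d) != 0.
  by apply: contra_notN D_lead => /eqP->; apply: vge0.
split=> //; apply/eqP; rewrite eq_le intD // andbT leNgt; apply/negP => lt.
by apply: D_lead => _; lia.
Qed.

Lemma upper_ramification_rho_trivial (n : nat) (lam : 'I_n -> K) (H : nat)
    (sigma : {rmorphism Ks -> Ks}) :
  generates Fq jK D Lam (fun i => jK (lam i)) ->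
  (forall i, (height v (lam i) <= H)%N) ->
  inertia_upper jK vs H.+1%:R sigma -> rho_trivial iA jK v E sigma.
Proof.
move=> [_ gen] hH hs t [tH _] I hI x hx; rewrite /rho.
have [_ _ [a [Ia a_res]]] := hI; have [N hD] := uniformization_unit_ends a_res.
have [b xb] := hx a Ia; have [_ tA t0] := tH I hI.
have tors : act (E a) (t I x) = 0 by rewrite -tA // mulrC xb t0.
have [z zE] := tate_surjective hstable (t I x).
have Lz : Lam (act (D a) z).
  by apply/(tate_kernel hstable); rewrite (tate_expA hstable) zE.
have [c cE] := gen _ Lz; have [tauD _ _] := tate_reduction hstable.
have [y yE] := choice (fun i =>
  tact_surjective iK hKs (unit_ends0 hD).1 (jK (lam i))).
have sy i : sigma (y i) = y i.
  exact: (upper_ramification_fixes iK hK hKs hvs hD hs (yE i) (hH i)).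
pose z' := \sum_i act (D (c i)) (y i).
have sz' : sigma z' = z'.
  rewrite rmorph_sum; apply: eq_bigr => i _.
  by rewrite (tact_galois Fq _ _ hs.1.1) sy.
have zz' : act (D a) (z - z') = 0.
  rewrite (tactB iK) cE (tact_sum iK); apply/eqP; rewrite subr_eq0; apply/eqP.
  apply: eq_bigr => i _; rewrite -yE.
  by rewrite -!(tactM iK) -!(tau_homM tauD) mulrC.
rewrite -zE; apply: (analytic_inertia (local_valuation hK) hvs
  (tate_analytic hstable) hs.1).
rewrite -[z](subrK z') rmorphD sz'; congr (_ + _).
exact: (inertia_fixes_torsion iK hvs hD hs.1 zz').
Qed.

End Uniformization.

Theorem theorem4p7
    (Fq : finFieldType)
    (K : fieldType) (iK : {rmorphism Fq -> K})
    (v : K -> int) (hK : local_field v)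
    (Ks : fieldType) (jK : {rmorphism K -> Ks}) (hKs : separable_closure jK)
    (vs : Ks -> rat) (hvs : extends_valuation jK v vs)
    (F : fieldExtType {fraction {poly Fq}})
    (inf : F -> int) (hinf : normalized_valuation inf)
    (A : comNzRingType) (iA : {rmorphism A -> F}) (hA : regular_ring inf iA)
    (E : A -> {poly K}) (hE : drinfeld_module iK iA E)
    (hchar : finite_residual_char v E)
    (D : A -> {poly K}) (Lam : Ks -> Prop) (e : Ks -> Ks)
    (hstable : tate_uniformization iK iA jK vs v E D Lam e)
    (hLam : forall x, Lam x -> exists y, x = jK y) :
  (exists m : nat, forall sigma : {rmorphism Ks -> Ks},
     inertia_upper jK vs m%:R sigma -> rho_trivial iA jK v E sigma) /\
  (forall (n : nat) (lam : 'I_n -> K),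
     generates Fq jK D Lam (fun i => jK (lam i)) ->
     forall sigma : {rmorphism Ks -> Ks},
       inertia_upper jK vs (\max_(i < n) height v (lam i))%N.+1%:R sigma ->
       rho_trivial iA jK v E sigma).
Proof.
have explicit (n : nat) (lam : 'I_n -> K) :
     generates Fq jK D Lam (fun i => jK (lam i)) ->
     forall sigma : {rmorphism Ks -> Ks},
       inertia_upper jK vs (\max_(i < n) height v (lam i))%N.+1%:R sigma ->
       rho_trivial iA jK v E sigma.
  move=> gen sigma.
  apply: (upper_ramification_rho_trivial hK hKs hvs hA hE hchar hstable gen).
  by move=> i; apply: (leq_bigmax_cond (F := fun i => height v (lam i))).
split=> //.
have [n [g [h [gL _ _ hP]]]] := tate_fg_projective hstable.
have [lam lamE] := choice (fun i => hLam _ (gL i)).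
exists (\max_(i < n) height v (lam i))%N.+1; apply: explicit.
split=> [i|x Lx]; first by rewrite -lamE.
by exists (h x); rewrite {1}(hP x Lx); apply: eq_bigr => i _; rewrite lamE.
Qed.
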